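(* Let $\mathcal{C}$ be a finite or Blaschke sequence in the open unit disk $\mathbb{D}$. A conformal pseudometric $\lambda(z)\,|dz|$ on $\mathbb{D}$ with constant curvature $-4$ and zero set $\mathcal{C}$ is the maximal conformal pseudometric $\lambda_{max}(z)\,|dz|$ on $\mathbb{D}$ with constant curvature $-4$ and zero set $\mathcal{C}$ if and only if $$\lim_{r\to1}\int_0^{2\pi}\log\frac{\lambda(re^{it})}{\lambda_{\mathbb{D}}(re^{it})}\,dt=0.$$
   Context: $\mathbb{D}=\{z\in\mathbb{C}:|z|<1\}$ and $\lambda_{\mathbb{D}}(z)=\frac{1}{1-|z|^2}$. A Blaschke sequence is a sequence $(a_j)$ in $\mathbb{D}$ with $\sum_j(1-|a_j|)<\infty$. A conformal pseudometric $\lambda(z)\,|dz|$ on a domain $G\subseteq\mathbb{C}$ is given by a continuous function $\lambda:G\to[0,+\infty)$, $\lambda\not\equiv0$ (its density); it is regular if $\lambda$ is of class $C^2$ on $\{z\in G:\lambda(z)>0\}$. For a continuous function $u$ the generalized lower Laplacian is $\Delta u(z)=\liminf_{r\to0}\frac{4}{r^2}\left(\frac1{2\pi}\int_0^{2\pi}u(z+re^{it})\,dt-u(z)\right)$, which is the usual Laplacian if $u$ is $C^2$. The (Gauss) curvature is $\kappa_\lambda(z)=-\Delta(\log\lambda)(z)/\lambda(z)^2$ at points with $\lambda(z)>0$. An SK-metric on $G$ is a conformal pseudometric with $\kappa_\lambda(z)\le-4$ for all $z\in G$ with $\lambda(z)>0$. Constant curvature $-4$ means regular with $\kappa_\lambda(z)=-4$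 wherever $\lambda(z)>0$. A sequence $\mathcal{C}$ of points in $G$ (repetitions allowed), in which the distinct points $z_j$ occur with multiplicity $m_j\in\mathbb{N}$, is the zero set of $\lambda(z)\,|dz|$ if $\lambda>0$ off $\mathcal{C}$ and for every $j$ the limit $\lim_{z\to z_j}\lambda(z)/|z-z_j|^{m_j}$ exists and is $\neq0$. Let $\Phi_{\mathcal{C}}$ be the family of all densities $\lambda$ of SK-metrics on $\mathbb{D}$ with $\limsup_{z\to z_j}\lambda(z)/|z-z_j|^{m_j}<+\infty$ for all $j$. If $\Phi_{\mathcal{C}}\neq\emptyset$, then $\lambda_{max}(z):=\sup_{\lambda\in\Phi_{\mathcal{C}}}\lambda(z)$, $z\in\mathbb{D}$, induces a regular conformal pseudometric of constant curvature $-4$ on $\mathbb{D}$ with zero set $\mathcal{C}$, called the maximal conformal pseudometric on $\mathbb{D}$ with constant curvature $-4$ and zero set $\mathcal{C}$. *)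

(* Defs.v *)
From mathcomp Require Import all_boot all_order all_algebra finmap.
From mathcomp Require Import all_classical all_reals all_analysis.
From mathcomp Require Export complex.
Import Order.TTheory GRing.Theory Num.Theory.
Import Normc numFieldNormedType.Exports.

Set Implicit Arguments.
Unset Strict Implicit.
Unset Printing Implicit Defensive.

Local Open Scope classical_set_scope.
Local Open Scope ring_scope.
Local Open Scope complex_scope.

(* [R[i]] carries no topology by itself; its alias [R[i]^o] has the usual one
   (its norm [`|z|] is [R[i]]-valued, while [normc z : R] is the real modulus).
   Densities are total functions on the plane of which only the values on the
   domain are used: every local notion below is only used at interior points
   of the domain. *)
Notation cplx R := (R[i]^o)%type.

Section ConformalPseudometrics.
Context {R : realType}.
Implicit Types (G : set (cplx R)) (l u : cplx R -> R) (z : cplx R).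

Definition unit_disk : set (cplx R) := [set z | normc z < 1].

Definition hyperbolic_density z : R := (1 - normc z ^+ 2)^-1.

Definition circle_point z (r t : R) : cplx R :=
  z + ((r * cos t) +i* (r * sin t)).

Definition dx u z : R := derive1 (fun t : R => u (z + (t +i* 0))) 0.
Definition dy u z : R := derive1 (fun t : R => u (z + (0 +i* t))) 0.

Definition C1_on G u : Prop := forall z, G z ->
  [/\ derivable (fun t : R => u (z + (t +i* 0))) 0 1,
      derivable (fun t : R => u (z + (0 +i* t))) 0 1,
      {for z, continuous (dx u)} & {for z, continuous (dy u)}].

Definition C2_on G u : Prop :=
  [/\ C1_on G u, C1_on G (dx u) & C1_on G (dy u)].

(* [u] is meant to be continuous near [z], so that the integrand is bounded
   for small [r] and the real-valued integral is the genuine one. *)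
Definition lower_laplacian u z : \bar R :=
  limf_einf (fun r : R =>
    (4 / r ^+ 2 *
     ((2 * pi)^-1 *
        (\int[lebesgue_measure]_(t in `[0%R, (2 * pi)%R]) u (circle_point z r t))
      - u z))%:E) 0^'+.

Definition curvature l z : \bar R :=
  (- lower_laplacian (fun w => ln (l w)) z * ((l z ^+ 2)^-1)%:E)%E.

Definition conformal_pseudometric G l : Prop :=
  [/\ {within G, continuous l}, forall z, G z -> 0 <= l z
    & exists2 z, G z & l z != 0].

Definition regular_density G l : Prop := C2_on [set z | G z /\ 0 < l z] l.

Definition SK_metric G l : Prop :=
  conformal_pseudometric G l /\
  forall z, G z -> 0 < l z -> (curvature l z <= (- 4)%:E)%E.

Definition constant_curvature_m4 G l : Prop :=
  regular_density G l /\
  forall z, G z -> 0 < l z -> curvature l z = (- 4)%:E.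

(* A sequence of points, repetitions allowed, is [a] restricted to the index
   set [I], which is an initial segment [`I_n] or the whole of [nat]. *)
Definition seq_points (I : set nat) (a : nat -> cplx R) : set (cplx R) := a @` I.

(* For finite and for Blaschke sequences this index set is always finite
   (otherwise [fset_set] would return the empty set). *)
Definition multiplicity (I : set nat) (a : nat -> cplx R) z : nat :=
  #|` fset_set [set j | I j /\ a j = z]|.

Definition finite_or_Blaschke (I : set nat) (a : nat -> cplx R) : Prop :=
  (forall j, I j -> unit_disk (a j)) /\
  ((exists n, I = `I_n) \/
   (I = setT /\ (\sum_(0 <= j <oo) (1 - normc (a j))%:E < +oo)%E)).

Definition has_zero_set G l (I : set nat) (a : nat -> cplx R) : Prop :=
  (forall z, G z -> ~ seq_points I a z -> 0 < l z) /\
  forall w, seq_points I a w -> exists2 c : R, c != 0 &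
    (l z / normc (z - w) ^+ multiplicity I a w) @[z --> w^'] --> c.

Definition Phi (I : set nat) (a : nat -> cplx R) : set (cplx R -> R) :=
  [set l | SK_metric unit_disk l /\
    forall w, seq_points I a w ->
      (limf_esup (fun z => (l z / normc (z - w) ^+ multiplicity I a w)%:E) w^'
         < +oo)%E].

Definition lambda_max (I : set nat) (a : nat -> cplx R) z : \bar R :=
  ereal_sup [set (l z)%:E | l in Phi I a].

End ConformalPseudometrics.

(* Main.v *)
Require Import Defs.
From mathcomp Require Import all_boot all_order all_algebra finmap.
From mathcomp Require Import all_classical all_reals all_analysis.
From mathcomp Require Import measurable_realfun ring lra.
Import Order.TTheory GRing.Theory Num.Theory.
Import Normc numFieldNormedType.Exports.

(** Write l for the given density and l_D for the hyperbolic one. By Ahlfors' lemma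
    ([ahlfors]) every density of an SK-metric on the disk is at most l_D, so
    ln(l/l_D) <= 0.

    If l is maximal, it dominates every member of the family that defines the
    maximal pseudometric. One of them is B l_D, where B is the modulus of the
    Blaschke product of the sequence ([blaschke_metric_Phi]): ln B is harmonic off
    the zeros, so the curvature of B l_D is -4/B^2 <= -4. Hence
    0 >= ln(l/l_D) >= ln B = - sum_j g_j, with g_j the Green function of the disk
    with pole a_j. The circle mean of g_j about 0 is the smaller one of -ln|a_j|
    and -ln r, and the sum of these numbers tends to 0 as r tends to 1
    ([blaschke_green_circle_integral_small]). So the mean of ln(l/l_D) tends to 0.

    Conversely let the means of G = -ln(l/l_D) >= 0 tend to 0 and let m belong to
    the family. On a circle |z| = r free of zeros, ln(m/l) <= G. The Poisson
    integral h of G majorizes ln(m/l) in the disk, because at an interior maximum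
    of ln(m/l) - h the inequality 4 m^2 <= 4 l^2 would hold where m > l
    ([comparison_on_disk]). By Harnack's inequality h(z) is at most a constant,
    independent of r near 1, times the mean of G, and r -> 1 gives m <= l
    ([zero_mean_dominates]). The zeros, where m/l is only bounded, are dealt with
    by adding a small multiple of ln B.

    Laplacians occur only through mean values over small circles. A function is
    used as harmonic through exact mean values over such circles, and these
    reduce to two duplication formulas, |1-w| |1+w| = |1-w^2| and
    1/(1-w) + 1/(1+w) = 2/(1-w^2) ([duplication_mean]). At a maximum of
    ln m - v the quotients of ln m are below those of v ([SK_touching]), and so are
    their lower limits, the generalized lower Laplacians. *)

Local Open Scope classical_set_scope.
Local Open Scope ring_scope.
Set Implicit Arguments.
Unset Strict Implicit.
Unset Printing Implicit Defensive.
Local Open Scope complex_scope.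
Local Notation Re := (@complex.Re _).
Local Notation Im := (@complex.Im _).

(** * The plane and its circles *)

Section plane.
Context {R : realType}.
Implicit Types (z w : cplx R).

Lemma normc_ge0 z : 0 <= normc z.
Proof. by case: z => x y; exact: sqrtr_ge0. Qed.

Lemma sqr_normc_ReIm z : normc z ^+ 2 = Re z ^+ 2 + Im z ^+ 2.
Proof. by case: z => x y /=; rewrite sqr_sqrtr ?addr_ge0 ?sqr_ge0. Qed.

Lemma normc_distC z w : normc (z - w) = normc (w - z).
Proof. by rewrite -normcN opprB. Qed.

Lemma normc_eq0 z : (normc z == 0) = (z == 0).
Proof. by apply/eqP/eqP => [/eq0_normc|->] //; rewrite normc0. Qed.

Lemma normc_gt0 z : (0 < normc z) = (z != 0).
Proof. by rewrite lt_def normc_ge0 andbT normc_eq0. Qed.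

Lemma ler_normcB z w : normc z - normc w <= normc (z - w).
Proof. by rewrite lerBlDr -{1}(subrK w z) le_normcD. Qed.

Lemma Re_le_normc z : `|Re z| <= normc z.
Proof.
rewrite -(ler_pXn2r (n:=2)) ?nnegrE ?normc_ge0//.
by rewrite sqr_normc_ReIm real_normK ?num_real// lerDl sqr_ge0.
Qed.

Lemma Im_le_normc z : `|Im z| <= normc z.
Proof.
rewrite -(ler_pXn2r (n:=2)) ?nnegrE ?normc_ge0//.
by rewrite sqr_normc_ReIm real_normK ?num_real// lerDr sqr_ge0.
Qed.

Lemma normc_le_ReIm z : normc z <= `|Re z| + `|Im z|.
Proof.
rewrite -(ler_pXn2r (n:=2)) ?nnegrE ?normc_ge0 ?addr_ge0//.
rewrite sqr_normc_ReIm -(real_normK (num_real (Re z))).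
rewrite -(real_normK (num_real (Im z))).
have := normr_ge0 (Re z); have := normr_ge0 (Im z); nra.
Qed.

Lemma norm_normc z : `|z| = (normc z)%:C.
Proof. by case: z => x y; rewrite normc_def. Qed.

(** The norm of the plane takes its values in R[i]; local arguments below are
    made with the real modulus instead. *)
Lemma nbhs_normcP z (A : set (cplx R)) :
  nbhs z A <-> exists2 e : R, 0 < e & forall w, normc (w - z) < e -> A w.
Proof.
split.
  move=> /nbhs_ballP[e /= e0 eA]; have := e0; case: e e0 eA => e1 e2 _ eA.
  rewrite ltcE /= => /andP[/eqP e20 e10]; exists e1 => // w wz.
  apply: eA; rewrite -ball_normE /= norm_normc ltcE /= e20 eqxx/=.
  by rewrite normc_distC.
move=> [e e0 eA]; apply/nbhs_ballP; exists (e%:C); first by rewrite /= ltcR.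
move=> w; rewrite -ball_normE/= norm_normc => H; apply: eA; move: H.
by rewrite normc_distC ltcR.
Qed.

Lemma continuous_normc_dist w : continuous (fun z => normc (z - w)).
Proof.
move=> z; apply/(@cvgrPdist_lt _ _ _ _ (nbhs_filter z)) => e e0.
apply/nbhs_normcP; exists e => // x xz.
rewrite ltr_norml; apply/andP; split.
  rewrite ltrNl opprB; apply: le_lt_trans xz.
  apply: le_trans (ler_normcB _ _) _.
  by rewrite opprB addrA subrK.
rewrite normc_distC in xz.
apply: le_lt_trans xz.
apply: le_trans (ler_normcB _ _) _.
by rewrite opprB addrA subrK.
Qed.

Lemma continuous_normc : continuous (@normc R : cplx R -> R).
Proof.
move=> z; have := @continuous_normc_dist 0 z.
by rewrite (_ : (fun x => _) = (@normc R)) //; apply/funext => x; rewrite subr0.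
Qed.

Lemma continuous_Re : continuous (Re : cplx R -> R).
Proof.
move=> z; apply/(@cvgrPdist_lt _ _ _ _ (nbhs_filter z)) => e e0.
apply/nbhs_normcP; exists e => // x xz.
rewrite normc_distC in xz.
apply: le_lt_trans xz; have := Re_le_normc (z - x).
by case: z x => ? ? [].
Qed.

Lemma cvg_complex T (F : set_system T) (FF : Filter F) (f g : T -> R) a b :
  f @ F --> a -> g @ F --> b ->
  (fun t => (f t +i* g t) : cplx R) @ F --> ((a +i* b) : cplx R).
Proof.
move=> fa gb A /nbhs_normcP[e e0 eA].
have e20 : 0 < e / 2 by rewrite divr_gt0.
have /cvgrPdist_lt/(_ _ e20) fa' := fa.
have /cvgrPdist_lt/(_ _ e20) gb' := gb.
apply: filterS (filterI fa' gb') => t [fat gbt].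
apply: eA; apply: le_lt_trans (normc_le_ReIm _) _.
rewrite (_ : Re _ = f t - a)// (_ : Im _ = g t - b)//.
by rewrite (splitr e) [X in X + _]distrC [X in _ + X]distrC ltrD.
Qed.

Lemma circle_point_ReIm z r t :
  circle_point z r t = (Re z + r * cos t) +i* (Im z + r * sin t).
Proof. by case: z. Qed.

Lemma continuous_circle_point z r : continuous (circle_point z r).
Proof.
rewrite (_ : circle_point z r =
    fun t => (Re z + r * cos t) +i* (Im z + r * sin t)); last first.
  by apply/funext => t; exact: circle_point_ReIm.
move=> t; apply: cvg_complex.
  apply: cvgD; first exact: cvg_cst.
  by apply: cvgM; [exact: cvg_cst|exact: continuous_cos].
apply: cvgD; first exact: cvg_cst.
by apply: cvgM; [exact: cvg_cst|exact: continuous_sin].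
Qed.

Lemma normc_circle_point z r t : 0 <= r -> normc (circle_point z r t - z) = r.
Proof.
move=> r0; rewrite addrAC subrr add0r /= !exprMn -mulrDr.
by rewrite cos2Dsin2 mulr1 sqrtr_sqr ger0_norm.
Qed.

Lemma normc_circle_point0 (r t : R) : 0 <= r -> normc (circle_point 0 r t) = r.
Proof. by move=> r0; have := @normc_circle_point 0 r t r0; rewrite subr0. Qed.

Lemma compact_closed_disk (r : R) : compact [set z : cplx R | normc z <= r].
Proof.
pose K : set (R * R) := `[- r, r]%classic `*` `[- r, r]%classic.
have cK : compact K by apply: compact_setX; exact: segment_compact.
pose f (q : R * R) : cplx R := q.1 +i* q.2.
have cf : continuous f.
  by move=> q; apply: cvg_complex; [exact: cvg_fst|exact: cvg_snd].
have -> : [set z : cplx R | normc z <= r] =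
    f @` (K `&` [set q | normc (f q) <= r]).
  apply/seteqP; split => [z zr|_ [q [_ qr] <-]//].
  exists (Re z, Im z); last by rewrite /f/=; case: z zr.
  split; last by rewrite /f/=; case: z zr.
  by split; rewrite /= in_itv/= -ler_norml; apply: le_trans zr;
    [exact: Re_le_normc|exact: Im_le_normc].
apply: continuous_compact.
  exact: continuous_subspaceT.
apply: compact_closedI => //.
apply: (@closed_comp _ _ (fun q => normc (f q)) [set x | x <= r]).
  move=> q _; apply: continuous_comp; first exact: cf.
  exact: continuous_normc.
exact: closed_le.
Qed.

End plane.

(** * Circle means by duplication *)

Section circle_integrals.
Context {R : realType}.
Implicit Types (z w q : cplx R) (f g : R -> R) (u v H : cplx R -> R).
Notation mu := (@lebesgue_measure R).

Lemma continuous_integrable f a b : continuous f ->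
  mu.-integrable `[a, b] (EFin \o f).
Proof.
move=> cf; apply: continuous_compact_integrable; first exact: segment_compact.
exact: continuous_subspaceT.
Qed.

Lemma Rintegral_affine f (k c a b : R) : continuous f -> 0 < k -> a <= b ->
  \int[mu]_(x in `[k * a + c, k * b + c]) f x =
  k * \int[mu]_(x in `[a, b]) f (k * x + c).
Proof.
move=> cf k0 ab; pose F x : R := k * x + c.
have dF (x : R) : is_derive x 1 F k.
  by rewrite /F; apply: is_derive_eq; rewrite addr0 /GRing.scale /= mulr1.
have F'E : derive1 F = cst k.
  by apply/funext => x; rewrite derive1E derive_val.
have cF : continuous F.
  by move=> x; apply: differentiable_continuous; apply/derivable1_diffP.
rewrite -RintegralZl//; last first.
  apply: continuous_integrable => x; apply: (@continuous_comp _ _ _ F); first exact: cF.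
  exact: cf.
rewrite /Rintegral; congr fine.
rewrite (@integration_by_substitution_increasing _ F)//.
- by apply: eq_integral => x _; rewrite F'E /= mulrC.
- by move=> x y _ _ xy; rewrite /F ltrD2r ltr_pM2l.
- by move=> x _; rewrite F'E; exact: cst_continuous.
- by rewrite F'E; exact: is_cvg_cst.
- by rewrite F'E; exact: is_cvg_cst.
- split => //.
  + by apply: cvg_at_right_filter; exact: cF.
  + by apply: cvg_at_left_filter; exact: cF.
- exact: continuous_subspaceT.
Qed.

Lemma Rintegral_split f (a b c : R) : continuous f -> a <= b -> b <= c ->
  \int[mu]_(x in `[a, c]) f x =
  \int[mu]_(x in `[a, b]) f x + \int[mu]_(x in `[b, c]) f x.
Proof.
move=> cf ab bc; have := @Rintegral_itvB _ f (BLeft a) (BRight c) b.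
move=> /(_ (continuous_integrable _ _ cf)); rewrite !bnd_simp => /(_ ab bc).
rewrite Rintegral_itv_obnd_cbnd; last first.
  apply: integrableS (@continuous_integrable f b c cf) => //.
  by apply: subset_itvr; rewrite bnd_simp.
by move=> <-; rewrite addrC subrK.
Qed.

Lemma Rintegral_double_angle f : continuous f ->
  \int[mu]_(x in `[0, 2 * pi]) f x =
  \int[mu]_(x in `[0, pi]) (f x + f (x + pi)).
Proof.
move=> cf; have p0 := pi_ge0 R.
rewrite (@Rintegral_split _ 0 pi)//; last by rewrite mulr_natl mulr2n lerDl.
have cfp : continuous (fun x => f (x + pi)).
  move=> x; apply: (@continuous_comp _ _ _ (fun x : R => x + pi) f); last exact: cf.
  by apply: cvgD; [exact: cvg_id|exact: cvg_cst].
rewrite RintegralD//; [|exact: continuous_integrable..].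
congr (_ + _).
have := @Rintegral_affine f 1 pi 0 pi cf ltr01 p0.
rewrite mulr0 add0r !mul1r mulr_natl mulr2n => ->.
by apply: eq_Rintegral => x _; rewrite mul1r.
Qed.

(** Fold the circle onto its upper half by t |-> t + pi, then unfold it by
    t |-> 2 t. *)
Lemma Rintegral_period_halves f g (c : R) : continuous f -> continuous g ->
  (forall t, f t + f (t + pi) = c * g (2 * t)) ->
  \int[mu]_(t in `[0, 2 * pi]) f t = c / 2 * \int[mu]_(t in `[0, 2 * pi]) g t.
Proof.
move=> cf cg fg; rewrite Rintegral_double_angle//.
under eq_Rintegral do rewrite fg.
have cg2 : continuous (fun t : R => g (2 * t)).
  move=> x; apply: (@continuous_comp _ _ _ (fun x : R => 2 * x) g); last exact: cg.
  by apply: cvgM; [exact: cvg_cst|exact: cvg_id].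
rewrite RintegralZl//; last exact: continuous_integrable.
have := @Rintegral_affine g 2 0 0 pi cg (ltr0Sn R 1) (pi_ge0 R).
rewrite mulr0 !addr0 => ->.
under [in RHS]eq_Rintegral do rewrite addr0.
by rewrite mulrA divfK// pnatr_eq0.
Qed.

Definition expi (t : R) : cplx R := cos t +i* sin t.

Lemma circle_point_expi z r t : circle_point z r t = z + r%:C * expi t.
Proof.
by rewrite /circle_point /expi; congr (_ + _); apply/eqP; rewrite eq_complex /=;
  rewrite !mul0r subr0 addr0 !eqxx.
Qed.

Lemma normc_expi t : normc (expi t) = 1.
Proof. by rewrite /= cos2Dsin2 sqrtr1. Qed.

Lemma expiDpi t : expi (t + pi) = - expi t.
Proof. by rewrite /expi cosDpi sinDpi. Qed.

Lemma expi_double t : expi (2 * t) = expi t * expi t.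
Proof.
by rewrite mulr_natl mulr2n /expi cosD sinD; apply/eqP;
  rewrite eq_complex /= eqxx/= addrC [cos t * _]mulrC.
Qed.

Lemma normc_real (x : R) : normc x%:C = `|x|.
Proof. by rewrite /= expr0n /= addr0 sqrtr_sqr. Qed.

Lemma normcX z n : normc (z ^+ n) = normc z ^+ n.
Proof.
elim: n => [|n ih]; first by rewrite !expr0 normc1.
by rewrite !exprS normcM ih.
Qed.

Lemma continuous_mul_expi q t0 : {for t0, continuous (fun t => q * expi t)}.
Proof.
rewrite (_ : (fun t => _) =
    fun t => (Re q * cos t - Im q * sin t) +i* (Re q * sin t + Im q * cos t)).
  apply: cvg_complex.
    apply: cvgB; (apply: cvgM; first exact: cvg_cst).
      exact: continuous_cos.
    exact: continuous_sin.
  apply: cvgD; (apply: cvgM; first exact: cvg_cst).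
    exact: continuous_sin.
  exact: continuous_cos.
by apply/funext => t; case: q.
Qed.

Lemma twopi_gt0 : 0 < 2 * pi :> R.
Proof. by rewrite mulr_gt0// pi_gt0. Qed.

Lemma Rintegral_2pi_cst (c : R) : \int[mu]_(t in `[0, 2 * pi]) c = 2 * pi * c.
Proof.
rewrite Rintegral_cst//= lebesgue_measure_itv/= lte_fin twopi_gt0/=.
by rewrite subr0 mulrC.
Qed.

(** The mean value property at 0, without Cauchy's formula. Adding the values at
    opposite points halves the circle, so the defect
    D(q) = int (H(q e^(it)) - H(0)) dt satisfies D(q) = c/2 D(q^2). Hence
    |D(q)| <= |D(q^(2^n))|, and this tends to 0 because q^(2^n) does and H is
    continuous at 0. *)
Lemma duplication_mean H (c : R) q : 0 <= c <= 2 ->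
  (forall w, normc w < 1 -> {for w, continuous H}) ->
  (forall w, normc w < 1 -> H w + H (- w) = c * H (w * w)) ->
  normc q < 1 ->
  \int[mu]_(t in `[0, 2 * pi]) H (q * expi t) = 2 * pi * H 0.
Proof.
move=> /andP[c0 c2] cH HH q1.
have H00 : H 0 + H 0 = c * H 0.
  by have := HH 0; rewrite oppr0 mulr0 normc0 => /(_ ltr01).
pose D w := \int[mu]_(t in `[0, 2 * pi]) (H (w * expi t) - H 0).
have inner w t : normc w < 1 -> normc (w * expi t) < 1.
  by rewrite normcM normc_expi mulr1.
have cHw w : normc w < 1 -> continuous (fun t => H (w * expi t)).
  move=> w1 t; apply: continuous_comp; first exact: continuous_mul_expi.
  by apply: cH; exact: inner.
have cHB w : normc w < 1 -> continuous (fun t => H (w * expi t) - H 0).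
  by move=> w1 t; apply: cvgB; [exact: cHw|exact: cvg_cst].
have sqw w : normc w < 1 -> normc (w * w) < 1.
  by move=> w1; rewrite normcM mulr_ilt1// normc_ge0.
have DD w : normc w < 1 -> D w = c / 2 * D (w * w).
  move=> w1; apply: (@Rintegral_period_halves (fun t => H (w * expi t) - H 0)
    (fun t => H (w * w * expi t) - H 0)).
  - exact: cHB.
  - by apply: cHB; exact: sqw.
  - move=> t /=; rewrite expiDpi expi_double mulrN.
    have := HH _ (inner _ t w1).
    rewrite (_ : w * w * (expi t * expi t) = w * expi t * (w * expi t)); last first.
      by rewrite mulrACA.
    by move=> h; rewrite mulrBr -h -H00; ring.
have Dle n w : normc w < 1 -> `|D w| <= `|D (w ^+ (2 ^ n))|.
  elim: n w => [|n ih] w w1; first by rewrite expn0 expr1.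
  rewrite DD// normrM; apply: (@le_trans _ _ `|D (w * w)|).
    rewrite ler_piMl// ger0_norm ?divr_ge0//.
    by rewrite ler_pdivrMr// mul1r.
  apply: le_trans (ih _ (sqw _ w1)) _.
  by rewrite expnS exprM expr2.
suff D0 : D q = 0.
  move: D0; rewrite /D RintegralB//; [|exact: (continuous_integrable _ _ (cHw _ q1))|].
    by rewrite Rintegral_2pi_cst => /eqP; rewrite subr_eq0 => /eqP.
  by apply: continuous_integrable => t; exact: cvg_cst.
apply/eqP; rewrite -normr_le0; apply/ler_addgt0Pl => e e0; rewrite addr0.
have e'0 : 0 < e / (2 * pi) by rewrite divr_gt0// twopi_gt0.
have := cH 0; rewrite normc0 => /(_ ltr01).
move=> /(@cvgrPdist_lt _ _ _ _ (nbhs_filter (0 : cplx R)))/(_ _ e'0).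
move=> /nbhs_normcP[d d0 Hd].
have [n qn] : exists n, normc q ^+ (2 ^ n) < d.
  have : (normc q ^+ n @[n --> \oo] --> (0 : R)).
    by apply: cvg_expr; rewrite ger0_norm ?normc_ge0.
  move=> /cvgrPdist_lt/(_ _ d0)[N _ /(_ (2 ^ N)%N)] /=.
  rewrite (ltnW (ltn_expl N _))// => /(_ isT).
  by rewrite sub0r normrN ger0_norm ?exprn_ge0 ?normc_ge0// => ?; exists N.
apply: le_trans (Dle n _ q1) _.
have q1n : normc (q ^+ (2 ^ n)) < 1.
  by rewrite normcX exprn_ilt1// ?normc_ge0// expn_eq0.
apply: le_trans (le_normr_Rintegral _ (continuous_integrable _ _ (cHB _ q1n))) _ => //.
apply: (@le_trans _ _ (\int[mu]_(t in `[0, 2 * pi]) (e / (2 * pi)))).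
  apply: le_Rintegral => //.
  - apply: continuous_integrable => t; apply: cvg_norm; exact: cHB.
  - by apply: continuous_integrable => t; exact: cvg_cst.
  - move=> t _; rewrite distrC ltW// Hd// subr0.
    by rewrite normcM normc_expi mulr1 normcX.
by rewrite Rintegral_2pi_cst mulrC divfK// gt_eqF// twopi_gt0.
Qed.

End circle_integrals.

(** * Mean values of logarithms and of fractions *)

Section mean_values.
Context {R : realType}.
Implicit Types (z w q k m : cplx R) (f g : R -> R) (u v H : cplx R -> R).
Notation mu := (@lebesgue_measure R).

Lemma continuous_ln_normc_dist w z : z != w ->
  {for z, continuous (fun x => ln (normc (x - w)))}.
Proof.
move=> zw; apply: (@continuous_comp _ _ _ (fun x => normc (x - w)) (@ln R)).
  exact: continuous_normc_dist.
by apply: continuous_ln; rewrite normc_gt0 subr_eq0.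
Qed.

(** The case c = 1 of the duplication formula: |1 - w| |1 + w| = |1 - w^2|. *)
Lemma mean_ln_1B q : normc q < 1 ->
  \int[mu]_(t in `[0, 2 * pi]) ln (normc (1 - q * expi t)) = 0.
Proof.
move=> q1; have neq1 w : normc w < 1 -> w != 1.
  by move=> w1; apply: contraTN w1 => /eqP ->; rewrite normc1 ltxx.
under eq_Rintegral do rewrite normc_distC.
have := @duplication_mean R (fun w => ln (normc (w - 1))) 1 q.
rewrite sub0r normcN normc1 ln1 mulr0; apply => //.
- by rewrite ler01 ler1n.
- by move=> w /neq1 w1; exact: continuous_ln_normc_dist.
- move=> w w1; rewrite mul1r -lnM ?posrE ?normc_gt0 ?subr_eq0 ?neq1 ?normcN//.
  rewrite -normcM -normcN; congr (ln (normc _)); ring.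
Qed.

Lemma mean_ln_affine k m : normc m < normc k ->
  \int[mu]_(t in `[0, 2 * pi]) ln (normc (k + m * expi t)) =
  2 * pi * ln (normc k).
Proof.
move=> mk; have k0 : k != 0.
  by rewrite -normc_gt0; apply: le_lt_trans mk; exact: normc_ge0.
have q1 : normc (- m / k) < 1.
  by rewrite normcM normcN normcV ltr_pdivrMr ?normc_gt0// mul1r.
have ne0 t : 0 < normc (1 - - m / k * expi t).
  rewrite normc_gt0 subr_eq0 eq_sym; apply: contraTN q1 => /eqP h.
  have := congr1 (@normc R) h; rewrite normcM normc_expi mulr1 normc1 => ->.
  by rewrite ltxx.
transitivity (\int[mu]_(t in `[0, 2 * pi])
    (ln (normc k) + ln (normc (1 - - m / k * expi t)))).
  apply: eq_Rintegral => t _; rewrite -lnM ?posrE ?ne0 ?normc_gt0//.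
  by rewrite -normcM; congr (ln (normc _)); field.
rewrite (@RintegralD _ _ _ mu _ (fun=> ln (normc k))
  (fun t => ln (normc (1 - - m / k * expi t))))//; last 2 first.
- by apply: continuous_integrable => t; exact: cvg_cst.
- apply: continuous_integrable => t.
  apply: (@continuous_comp _ _ _ (fun t => normc (1 - - m / k * expi t)) (@ln R)).
    have -> : (fun t => normc (1 - - m / k * expi t)) =
        (fun x => normc (x - 1)) \o (fun t => - m / k * expi t).
      by apply/funext => x /=; exact: normc_distC.
    apply: continuous_comp; first exact: continuous_mul_expi.
    exact: continuous_normc_dist.
  exact: continuous_ln.
by rewrite mean_ln_1B// addr0 Rintegral_2pi_cst.
Qed.

Lemma normc_conj z : normc (z^*)%C = normc z.
Proof. by case: z => x y /=; rewrite sqrrN. Qed.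

Lemma expi_conj t : expi t * ((expi t)^*)%C = 1 :> cplx R.
Proof.
apply/eqP; rewrite eq_complex /= mulrN opprK -!expr2 cos2Dsin2 eqxx /=.
by rewrite mulrN mulrC addNr.
Qed.

(** Division by e^(it) and conjugation exchange k and m; so the case |k| < |m| of
    the mean of ln|k + m e^(it)| reduces to the case |m| < |k|. *)
Lemma normc_affine_swap k m t :
  normc (k + m * expi t) = normc ((m^*)%C + (k^*)%C * expi t).
Proof.
rewrite -normc_conj rmorphD rmorphM /=.
rewrite -[LHS]mul1r -(normc_expi t) -normcM; congr normc.
by rewrite mulrDr mulrCA expi_conj mulr1 addrC [X in _ + X]mulrC.
Qed.

Lemma mean_ln_affine_gt k m : normc k < normc m ->
  \int[mu]_(t in `[0, 2 * pi]) ln (normc (k + m * expi t)) =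
  2 * pi * ln (normc m).
Proof.
move=> km; under eq_Rintegral do rewrite normc_affine_swap.
by rewrite mean_ln_affine ?normc_conj.
Qed.

Lemma continuous_Re_div k w : w != 1 ->
  {for w, continuous (fun x : cplx R => Re (k / (1 - x)))}.
Proof.
move=> w1; apply: (@continuous_comp _ _ _ (fun x : cplx R => (k / (1 - x) : cplx R))).
  pose FF := @nbhs_filter _ w; apply: (@cvgM _ _ (nbhs w) FF).
    exact: (@cvg_cst _ _ _ (nbhs w) FF).
  apply: (@cvgV _ _ (nbhs w) FF); first by rewrite subr_eq0 eq_sym.
  apply: (@cvgB _ _ _ (nbhs w) FF); first exact: (@cvg_cst _ _ _ (nbhs w) FF).
  exact: cvg_id.
exact: continuous_Re.
Qed.

(** The case c = 2 of the duplication formula: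
    1/(1 - w) + 1/(1 + w) = 2/(1 - w^2). *)
Lemma mean_Re_inv1B k q : normc q < 1 ->
  \int[mu]_(t in `[0, 2 * pi]) Re (k / (1 - q * expi t)) = 2 * pi * Re k.
Proof.
move=> q1; have neq1 w : normc w < 1 -> w != 1.
  by move=> w1; apply: contraTN w1 => /eqP ->; rewrite normc1 ltxx.
have := @duplication_mean R (fun w => Re (k / (1 - w))) 2 q.
rewrite subr0 invr1 mulr1; apply => //.
- by rewrite ler0n lexx.
- by move=> w /neq1; exact: continuous_Re_div.
- move=> w w1.
  have h1 : 1 - w != 0 by rewrite subr_eq0 eq_sym neq1.
  have h2 : 1 + w != 0.
    by rewrite -[w]opprK subr_eq0 eq_sym neq1// normcN.
  have h3 : 1 - w * w != 0.
    by rewrite (_ : 1 - w * w = (1 - w) * (1 + w)); [rewrite mulf_neq0|ring].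
  have -> : 2 * Re (k / (1 - w * w)) = Re (2 * (k / (1 - w * w))).
    by case: (k / _) => x y; rewrite mulr_natl [in RHS]mulr_natl !mulr2n.
  have -> : 2 * (k / (1 - w * w)) = k / (1 - w) + k / (1 - - w).
    by rewrite opprK; field; rewrite h1 h2 h3.
  by case: (k / (1 - w)) (k / (1 - - w)) => ? ? [].
Qed.

Lemma mean_Re_div_affine k m q : normc q < normc m ->
  \int[mu]_(t in `[0, 2 * pi]) Re (k / (m + q * expi t)) = 2 * pi * Re (k / m).
Proof.
move=> qm; have m0 : m != 0.
  by rewrite -normc_gt0; apply: le_lt_trans qm; exact: normc_ge0.
have q1 : normc (- q / m) < 1.
  by rewrite normcM normcN normcV ltr_pdivrMr ?normc_gt0// mul1r.
rewrite -(@mean_Re_inv1B (k / m) (- q / m))//.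
apply: eq_Rintegral => t _; congr (Re _).
by rewrite -mulrA -invfM; congr (_ / _); field.
Qed.

End mean_values.

(** * The generalized lower Laplacian *)

Section lower_limits.
Context {R : realType} {T : choiceType} {X : filteredType T}.
Implicit Types (f g : X -> \bar R) (F : set_system X).
Local Open Scope ereal_scope.

Lemma limf_einf_ge f F (c : \bar R) : Filter F ->
  (\forall x \near F, c <= f x) -> c <= limf_einf f F.
Proof.
move=> FF Fc; rewrite limf_einfE.
apply: le_ereal_sup_tmp; exists (ereal_inf (f @` [set x | c <= f x])).
  by exists [set x | c <= f x].
by apply: le_ereal_inf_tmp => _ [x cx <-].
Qed.

Lemma limf_einf_mono f g F : Filter F ->
  (\forall x \near F, f x <= g x) -> limf_einf f F <= limf_einf g F.
Proof.
move=> FF fg; rewrite [leLHS]limf_einfE; apply: ge_ereal_sup => _ [A FA <-].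
apply: limf_einf_ge; apply: filterS (filterI FA fg) => x [Ax fgx].
by apply: le_trans fgx; apply: ereal_inf_lbound; exists x.
Qed.

Lemma limf_einf_le f F (c : \bar R) : ProperFilter F ->
  (\forall x \near F, f x <= c) -> limf_einf f F <= c.
Proof.
move=> FF Fc; rewrite limf_einfE; apply: ge_ereal_sup => _ [A FA <-].
have [x [Ax fx]] := filter_ex (filterI FA Fc).
by apply: le_trans fx; apply: ereal_inf_lbound; exists x.
Qed.

Lemma limf_esup_lt f F (c : \bar R) : Filter F ->
  limf_esup f F < c -> \forall x \near F, f x < c.
Proof.
move=> FF; rewrite limf_esupE => /ereal_inf_lt[_ [A FA <-]] Ac.
apply: filterS FA => x Ax; apply: le_lt_trans Ac.
by apply: ereal_sup_ubound; exists x.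
Qed.

Lemma limf_esup_le f F (c : \bar R) : Filter F ->
  (\forall x \near F, f x <= c) -> limf_esup f F <= c.
Proof.
move=> FF Fc; rewrite limf_esupE.
apply: ge_ereal_inf; exists (ereal_sup (f @` [set x | f x <= c])).
  by exists [set x | f x <= c].
by apply: ge_ereal_sup => _ [x cx <-].
Qed.

End lower_limits.

Section lower_laplacian.
Context {R : realType}.
Implicit Types (z w : cplx R) (u v g : cplx R -> R).
Notation mu := (@lebesgue_measure R).

Definition circle_integral u z (r : R) : R :=
  \int[mu]_(t in `[0, 2 * pi]) u (circle_point z r t).

(** The mean value is required exactly for all small radii, and not only up to
    o(r^2), so that a function with this property adds nothing to any of the
    quotients in the lower Laplacian. *)
Definition mean_value_at u z : Prop :=
  \forall r \near (0 : R)^'+, circle_integral u z r = 2 * pi * u z.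

Lemma near_circle (P : set (cplx R)) z : nbhs z P ->
  \forall r \near (0 : R)^'+, forall t, P (circle_point z r t).
Proof.
move=> /nbhs_normcP[e e0 eP]; near=> r => t; apply: eP.
have r0 : 0 < r by near: r; exact: nbhs_right_gt.
by rewrite normc_circle_point ?ltW//; near: r; exact: nbhs_right_lt.
Unshelve. all: by end_near. Qed.

Lemma near_circle_continuous u z : (\forall w \near z, {for w, continuous u}) ->
  \forall r \near (0 : R)^'+, continuous (fun t => u (circle_point z r t)).
Proof.
move=> /near_circle; apply: filterS => r cu t.
by apply: continuous_comp; [exact: continuous_circle_point|exact: cu].
Qed.

Lemma lower_laplacian_mono u v z :
  (\forall r \near (0 : R)^'+, circle_integral u z r - 2 * pi * u z <=
                         circle_integral v z r - 2 * pi * v z) ->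
  (lower_laplacian u z <= lower_laplacian v z)%E.
Proof.
move=> uv; apply: limf_einf_mono; apply: filterS uv => r uv.
rewrite lee_fin; apply: ler_wpM2l; first by rewrite divr_ge0// sqr_ge0.
have p0 := @twopi_gt0 R.
rewrite -(ler_pM2l p0) !mulrBr !mulrA divff ?gt_eqF// !mul1r.
exact: uv.
Qed.

Lemma lower_laplacian_eq u v z :
  (\forall r \near (0 : R)^'+, circle_integral u z r - 2 * pi * u z =
                         circle_integral v z r - 2 * pi * v z) ->
  lower_laplacian u z = lower_laplacian v z.
Proof.
move=> uv; apply/eqP; rewrite eq_le; apply/andP; split;
  by apply: lower_laplacian_mono; apply: filterS uv => r ->.
Qed.

(** The lower Laplacian is only superadditive, but a summand with exact mean
    values changes none of the quotients of which it is the lower limit. *)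
Lemma lower_laplacianD_mean_value u v g z :
  (\forall w \near z, {for w, continuous v}) ->
  (\forall w \near z, {for w, continuous g}) ->
  (\forall w \near z, u w = v w + g w) ->
  mean_value_at g z ->
  lower_laplacian u z = lower_laplacian v z.
Proof.
move=> cv cg uvg mg; apply: lower_laplacian_eq.
have uvg' := near_circle uvg.
have cv' := near_circle_continuous cv.
have cg' := near_circle_continuous cg.
near=> r.
have ug : forall t, u (circle_point z r t) =
    v (circle_point z r t) + g (circle_point z r t).
  by near: r.
rewrite {1}/circle_integral; under eq_Rintegral do rewrite ug.
rewrite RintegralD//; last 2 first.
- by apply: continuous_integrable; near: r.
- by apply: continuous_integrable; near: r.
rewrite (nbhs_singleton uvg) -/(circle_integral v z r) -/(circle_integral g z r).
have -> : circle_integral g z r = 2 * pi * g z by near: r.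
by ring.
Unshelve. all: by end_near. Qed.

End lower_laplacian.

(** * Circle means of the hyperbolic potential *)

Section hyperbolic.
Context {R : realType}.
Implicit Types (z w : cplx R) (rho r : R).
Notation mu := (@lebesgue_measure R).

Definition disk_gap rho z : R := rho ^+ 2 - normc z ^+ 2.

Lemma sqr_normcD z w :
  normc (z + w) ^+ 2 = normc z ^+ 2 + 2 * Re ((z^*)%C * w) + normc w ^+ 2.
Proof. by rewrite !sqr_normc_ReIm; case: z w => a b [c d] /=; ring. Qed.

Lemma ReN z : Re (- z) = - Re z.
Proof. by case: z. Qed.

Lemma Re_realM (x : R) z : Re (x%:C * z) = x * Re z.
Proof. by case: z => a b /=; rewrite mul0r subr0. Qed.

(** One has rho^2 - |z + r e^(it)|^2 = c |1 - q e^(it)|^2 with q = r conj(z)/c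
    as soon as c + (r|z|)^2/c = rho^2 - |z|^2 - r^2. This is the larger root c
    of that equation, the one for which |q| < 1. *)
Definition gap_mean rho z r : R :=
  let A := disk_gap rho z - r ^+ 2 in
  (A + Num.sqrt (A ^+ 2 - 4 * (r * normc z) ^+ 2)) / 2.

Lemma gap_meanP rho z r : 0 < r -> normc z + r < rho ->
  let c := gap_mean rho z r in
  [/\ r * normc z < c, (disk_gap rho z - r ^+ 2) / 2 <= c &
      c + (r * normc z) ^+ 2 / c = disk_gap rho z - r ^+ 2].
Proof.
move=> r0 Nr; rewrite /gap_mean /disk_gap.
set N := normc z in Nr *; set A := _ - _ - r ^+ 2.
have N0 : 0 <= N by exact: normc_ge0.
have A2 : 2 * (r * N) < A by rewrite /A; nra.
have rN0 : 0 <= r * N by rewrite mulr_ge0// ltW.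
have D0 : 0 <= A ^+ 2 - 4 * (r * N) ^+ 2 by nra.
have s0 := sqrtr_ge0 (A ^+ 2 - 4 * (r * N) ^+ 2).
have ss := sqr_sqrtr D0; move: s0 ss.
set s := Num.sqrt _ => s0 ss.
have c0 : (A + s) / 2 != 0 by rewrite gt_eqF//; lra.
split; [lra|lra|].
apply: (mulIf c0); rewrite mulrDl divfK//.
have -> : (r * N) ^+ 2 = (A ^+ 2 - s ^+ 2) / 4 by rewrite ss; field.
by field.
Qed.

(** In the factorization by gap_mean, the factor |1 - q e^(it)| has logarithmic
    mean 0. *)
Lemma circle_integral_ln_gap rho z r : 0 < r -> normc z + r < rho ->
  circle_integral (fun w => ln (disk_gap rho w)) z r =
  2 * pi * ln (gap_mean rho z r).
Proof.
move=> r0 Nr; have [] := gap_meanP r0 Nr.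
set c := gap_mean _ _ _ => rNc _ cE.
have c0 : 0 < c by apply: le_lt_trans rNc; rewrite mulr_ge0 ?normc_ge0 ?ltW.
pose q : cplx R := (r / c)%:C * (z^*)%C.
have nq : normc q = r * normc z / c.
  rewrite normcM normc_real normc_conj ger0_norm; last first.
      by rewrite divr_ge0 ?ltW.
    by rewrite mulrAC.
have q1 : normc (- q) < normc (1 : cplx R).
  by rewrite normcN nq normc1 ltr_pdivrMr// mul1r.
have pos t : 0 < normc (1 - q * expi t).
  rewrite normc_gt0 subr_eq0 eq_sym; apply: contraTN q1 => /eqP h.
  have := congr1 (@normc R) h; rewrite normcM normc_expi mulr1 normc1 normcN => ->.
  by rewrite ltxx.
have cln : continuous (fun t => ln (normc (1 + - q * expi t))).
  move=> t; apply: (@continuous_comp _ _ _ (fun t => normc (1 + - q * expi t)) (@ln R)).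
    have -> : (fun t => normc (1 + - q * expi t)) =
        (fun x => normc (x - (- 1))) \o (fun t => - q * expi t).
      by apply/funext => x /=; rewrite opprK addrC.
    apply: continuous_comp; first exact: continuous_mul_expi.
    exact: continuous_normc_dist.
  by apply: continuous_ln; rewrite mulNr pos.
transitivity (\int[mu]_(t in `[0, 2 * pi])
   (ln c + 2 * ln (normc (1 + - q * expi t)))).
  apply: eq_Rintegral => t _; rewrite mulNr.
  rewrite mulr_natl -lnXn ?pos// -lnM ?posrE ?exprn_gt0 ?pos//; congr ln.
  rewrite /disk_gap circle_point_expi sqr_normcD normcM normc_expi normc_real mulr1.
  rewrite sqr_normcD normcN normcM normc_expi mulr1 normc1 nq.
  have -> : Re ((1^*)%C * - (q * expi t)) = - (r / c * Re ((z^*)%C * expi t)).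
    by rewrite rmorph1 mul1r ReN /q -(mulrA (r / c)%:C) Re_realM.
  have -> : Re ((z^*)%C * (r%:C * expi t)) = r * Re ((z^*)%C * expi t).
    by rewrite mulrCA Re_realM.
  rewrite real_normK ?num_real//.
  have -> : rho ^+ 2 - (normc z ^+ 2 + 2 * (r * Re ((z^*)%C * expi t)) + r ^+ 2) =
     disk_gap rho z - r ^+ 2 - 2 * r * Re ((z^*)%C * expi t).
    by rewrite /disk_gap; ring.
  by rewrite -cE; field; rewrite gt_eqF.
rewrite (@RintegralD _ _ _ mu _ (fun=> ln c)
  (fun t => 2 * ln (normc (1 + - q * expi t))))//; last 2 first.
- by apply: continuous_integrable => t; exact: cvg_cst.
- by apply: continuous_integrable => t; apply: cvgM; [exact: cvg_cst|exact: cln].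
rewrite RintegralZl//; last exact: continuous_integrable.
by rewrite mean_ln_affine// normc1 ln1 !mulr0 addr0 Rintegral_2pi_cst.
Qed.

End hyperbolic.

(** * A maximum principle for SK-metrics *)

Section max_principle.
Context {R : realType}.
Implicit Types (z w : cplx R) (rho r : R) (m u v E : cplx R -> R).
Notation mu := (@lebesgue_measure R).

Lemma open_disk rho : open [set z : cplx R | normc z < rho].
Proof.
rewrite openE => z /= zr; apply/nbhs_normcP; exists (rho - normc z).
  by rewrite subr_gt0.
move=> w; rewrite ltrBrDr; apply: le_lt_trans.
by rewrite -{1}(subrK z w); exact: le_normcD.
Qed.

Lemma near_disk rho z : normc z < rho -> \forall w \near z, normc w < rho.
Proof. by move=> zr; have := @open_disk rho; rewrite openE; exact. Qed.

Lemma disk_continuous m z : {within unit_disk, continuous m} ->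
  unit_disk z -> {for z, continuous m}.
Proof.
rewrite continuous_open_subspace; last exact: open_disk.
by move=> cm zD; apply: cm; rewrite inE.
Qed.

Lemma near_disk_continuous m z : {within unit_disk, continuous m} ->
  unit_disk z -> \forall w \near z, {for w, continuous m}.
Proof.
move=> cm zD; apply: filterS (near_disk zD) => w wD; exact: disk_continuous.
Qed.

Lemma near_gt0 u z : {for z, continuous u} -> 0 < u z ->
  \forall w \near z, 0 < u w.
Proof.
move=> cu u0; apply: (cu [set x | 0 < x]).
by apply: open_nbhs_nbhs; split; [exact: open_gt|].
Qed.

Lemma near_continuous_ln u z : (\forall w \near z, {for w, continuous u}) ->
  0 < u z -> \forall w \near z, {for w, continuous (fun x => ln (u x))}.
Proof.
move=> cu u0; apply: filterS (filterI cu (near_gt0 (nbhs_singleton cu) u0)).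
move=> w [cw w0]; apply: (@continuous_comp _ _ _ u (@ln R)) => //.
exact: continuous_ln.
Qed.

Lemma curvature_le_lower_laplacian m z : 0 < m z ->
  (curvature m z <= (- 4)%:E)%E ->
  ((4 * m z ^+ 2)%:E <= lower_laplacian (fun w => ln (m w)) z)%E.
Proof.
move=> m0; rewrite /curvature; have m20 : 0 < m z ^+ 2 by rewrite exprn_gt0.
case: (lower_laplacian _ z) => [l| |]; last 2 first.
- by rewrite leey.
- by rewrite /= mulyr gtr0_sg ?invr_gt0// mul1e leye_eq.
by rewrite !lee_fin ler_pdivrMr// mulNr lerN2.
Qed.

Lemma curvature_eq_lower_laplacian m z : 0 < m z ->
  curvature m z = (- 4)%:E ->
  lower_laplacian (fun w => ln (m w)) z = (4 * m z ^+ 2)%:E.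
Proof.
move=> m0; rewrite /curvature; have m20 : 0 < m z ^+ 2 by rewrite exprn_gt0.
case: (lower_laplacian _ z) => [l| |].
- rewrite -EFinN -EFinM => -[/(congr1 ( *%R^~ (m z ^+ 2)))].
  by rewrite /= divfK ?gt_eqF// mulNr => /oppr_inj ->.
- by rewrite /= mulNyr gtr0_sg ?invr_gt0// mul1e.
- by rewrite /= mulyr gtr0_sg ?invr_gt0// mul1e.
Qed.

(** If m exp(-v) has a local maximum at z, then ln m - v has one, hence each
    quotient of ln m at z is at most the quotient of v. *)
Lemma SK_touching m v z : SK_metric unit_disk m -> unit_disk z -> 0 < m z ->
  (\forall w \near z, {for w, continuous v}) ->
  (\forall w \near z, m w * expR (- v w) <= m z * expR (- v z)) ->
  ((4 * m z ^+ 2)%:E <= lower_laplacian v z)%E.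
Proof.
move=> [[cm _ _] curv] zD m0 cv mv.
apply: le_trans (curvature_le_lower_laplacian m0 (curv _ zD m0)) _.
have cnm := near_disk_continuous cm zD.
apply: lower_laplacian_mono.
have cl := near_circle_continuous (near_continuous_ln cnm m0).
have cv' := near_circle_continuous cv.
have := near_circle (filterI mv (near_gt0 (nbhs_singleton cnm) m0)).
move=> le_mv; near=> r.
have le_r : forall t, ln (m (circle_point z r t)) + - v (circle_point z r t) <=
    ln (m z) - v z.
  move=> t; have [h h0] : m (circle_point z r t) * expR (- v (circle_point z r t)) <=
     m z * expR (- v z) /\ 0 < m (circle_point z r t).
    by move: t; near: r; exact: le_mv.
  rewrite -[X in _ + X]expRK -lnM ?posrE ?expR_gt0// -[X in _ <= _ + X]expRK.
  by rewrite -lnM ?posrE ?expR_gt0// ler_ln ?posrE ?mulr_gt0 ?expR_gt0.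
have cl' : continuous (fun t => ln (m (circle_point z r t))) by near: r.
have cv'' : continuous (fun t => v (circle_point z r t)) by near: r.
rewrite lerBlDr -lerBlDl opprB addrCA -lerBrDl -mulrBr.
rewrite -Rintegral_2pi_cst /circle_integral -RintegralB//;
  [|exact: continuous_integrable..].
apply: le_Rintegral => //.
- by apply: continuous_integrable => t; apply: cvgB; [exact: cl'|exact: cv''].
- by apply: continuous_integrable => t; exact: cvg_cst.
Unshelve. all: by end_near. Qed.

(** At an interior maximum above K, the function v touches ln m from above, so
    its lower Laplacian would be at least 4 m^2. *)
Lemma SK_max_principle m v E rho K : SK_metric unit_disk m ->
  rho < 1 ->
  {within [set z : cplx R | normc z <= rho], continuous E} ->
  (forall z, normc z = rho -> E z <= K) ->
  (forall z, normc z < rho -> K < E z ->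
    [/\ 0 < m z, \forall w \near z, {for w, continuous v},
      \forall w \near z, E w = m w * expR (- v w) &
      (lower_laplacian v z < (4 * m z ^+ 2)%:E)%E]) ->
  forall z, normc z <= rho -> E z <= K.
Proof.
move=> SKm rho1 cE EK H z zrho; have ne : [set z : cplx R | normc z <= rho] !=set0.
  by exists z.
have [c] := compact_EVT_max ne (@compact_closed_disk R rho) cE.
rewrite inE /= => crho cmax.
apply: le_trans (cmax _ (mem_set zrho)) _; rewrite leNgt; apply/negP => KE.
move: crho; rewrite le_eqVlt => /predU1P[/EK|crho]; first by rewrite leNgt KE.
have [mc cv Ev] := H _ crho KE; apply/negP; rewrite -leNgt.
apply: SK_touching => //; first exact: lt_trans rho1.
near=> w; have <- : E w = m w * expR (- v w) by near: w.
rewrite -(nbhs_singleton Ev); apply: cmax; rewrite inE /= ltW//.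
by near: w; exact: near_disk.
Unshelve. all: by end_near. Qed.

End max_principle.

(** * Ahlfors' lemma *)

Section hyperbolic_metric.
Context {R : realType}.
Implicit Types (z w : cplx R) (rho r : R) (m u v E : cplx R -> R).
Notation mu := (@lebesgue_measure R).

(** The hyperbolic density of the disk of radius rho; it blows up on the circle
    of radius rho. *)
Definition hyp rho z : R := rho / disk_gap rho z.

Lemma hyp1 z : hyp 1 z = hyperbolic_density z.
Proof. by rewrite /hyp /disk_gap expr1n div1r. Qed.

Lemma disk_gap_gt0 rho z : 0 <= rho -> (0 < disk_gap rho z) = (normc z < rho).
Proof.
by move=> rho0; rewrite subr_gt0 ltr_pXn2r ?nnegrE ?normc_ge0.
Qed.

Lemma continuous_disk_gap rho : continuous (disk_gap rho : cplx R -> R).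
Proof.
move=> z; apply: (@cvgB _ _ _ (nbhs z) (nbhs_filter z)).
  exact: (@cvg_cst _ _ _ (nbhs z) (nbhs_filter z)).
apply: (@cvgM _ _ (nbhs z) (nbhs_filter z)); exact: continuous_normc.
Qed.

Lemma continuous_hyp rho z : 0 <= rho -> normc z < rho -> {for z, continuous (hyp rho)}.
Proof.
move=> rho0 zr; apply: (@cvgM _ _ (nbhs z) (nbhs_filter z)).
  exact: (@cvg_cst _ _ _ (nbhs z) (nbhs_filter z)).
apply: (@cvgV _ _ (nbhs z) (nbhs_filter z)); last exact: continuous_disk_gap.
by rewrite gt_eqF// disk_gap_gt0.
Qed.

Lemma hyp_gt0 rho z : normc z < rho -> 0 < hyp rho z.
Proof.
move=> zr; have rho0 : 0 < rho by apply: le_lt_trans zr; exact: normc_ge0.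
by rewrite divr_gt0// disk_gap_gt0// ltW.
Qed.

Lemma near_continuous_ln_hyp rho z : normc z < rho ->
  \forall w \near z, {for w, continuous (fun x => ln (hyp rho x))}.
Proof.
move=> zr; apply: near_continuous_ln; last exact: hyp_gt0.
apply: filterS (near_disk zr) => w wr; apply: continuous_hyp => //.
by apply: le_trans (ltW wr); exact: normc_ge0.
Qed.

Lemma ln_le_subr1 (x : R) : 0 < x -> ln x <= x - 1.
Proof.
move=> x0; have := @le_ln1Dx R (x - 1); rewrite (addrC 1) subrK; apply; lra.
Qed.

Lemma le_normc_circle_point z r t : 0 <= r ->
  normc (circle_point z r t) <= normc z + r.
Proof.
move=> r0; rewrite circle_point_expi; apply: le_trans (le_normcD _ _) _.
by rewrite normcM normc_expi mulr1 normc_real ger0_norm.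
Qed.

Lemma circle_integral_ln_hyp rho z r : 0 < r -> normc z + r < rho ->
  circle_integral (fun w => ln (hyp rho w)) z r =
  2 * pi * (ln rho - ln (gap_mean rho z r)).
Proof.
move=> r0 Nr; have rho0 : 0 < rho.
  by apply: lt_trans Nr; rewrite ltr_pwDr ?normc_ge0.
have circ t : normc (circle_point z r t) < rho.
  by apply: le_lt_trans Nr; apply: le_normc_circle_point; exact: ltW.
transitivity (\int[mu]_(t in `[0, 2 * pi])
   (ln rho - ln (disk_gap rho (circle_point z r t)))).
  apply: eq_Rintegral => t _.
  by rewrite ln_div ?posrE ?disk_gap_gt0// ltW.
rewrite (@RintegralB _ _ _ mu _ (fun=> ln rho))//.
- rewrite Rintegral_2pi_cst mulrBr; congr (_ - _).
  exact: circle_integral_ln_gap.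
- by apply: continuous_integrable => t; exact: cvg_cst.
- apply: continuous_integrable => t.
  apply: (@continuous_comp _ _ _ (fun t => disk_gap rho (circle_point z r t)) (@ln R)).
    apply: continuous_comp; first exact: continuous_circle_point.
    exact: continuous_disk_gap.
  by apply: continuous_ln; rewrite disk_gap_gt0 ?ltW.
Qed.

Lemma near_circle_in_disk rho z : normc z < rho ->
  \forall r \near (0 : R)^'+, 0 < r /\ normc z + r < rho.
Proof.
move=> zr; near=> r; split; first by near: r; exact: nbhs_right_gt.
by rewrite -ltrBrDl; near: r; apply: nbhs_right_lt; rewrite subr_gt0.
Unshelve. all: by end_near. Qed.

Lemma hyp_quotient rho z r : 0 < r -> normc z + r < rho ->
  4 / r ^+ 2 * ((2 * pi)^-1 * circle_integral (fun w => ln (hyp rho w)) z r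
                 - ln (hyp rho z)) =
  4 / r ^+ 2 * (ln (disk_gap rho z) - ln (gap_mean rho z r)).
Proof.
move=> r0 Nr; rewrite circle_integral_ln_hyp// mulrA mulVf ?gt_eqF ?twopi_gt0//.
have zr : normc z < rho by apply: le_lt_trans Nr; rewrite lerDl ltW.
have rho0 : 0 < rho by apply: le_lt_trans zr; exact: normc_ge0.
by rewrite mul1r /hyp ln_div ?posrE ?disk_gap_gt0 ?(ltW rho0)//; ring.
Qed.

(** The quotient is 4/r^2 (ln A - ln c) with A = rho^2 - |z|^2 and c the
    geometric mean of the gap on the circle. Since c <= A - r^2 rho^2/A, the
    inequality ln(A/c) >= 1 - c/A gives the bound for every small r. *)
Lemma lower_laplacian_hyp_ge rho z : normc z < rho ->
  ((4 * hyp rho z ^+ 2)%:E <= lower_laplacian (fun w => ln (hyp rho w)) z)%E.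
Proof.
move=> zr; apply: limf_einf_ge; apply: filterS (near_circle_in_disk zr) => r [r0 Nr].
rewrite hyp_quotient// lee_fin.
have rho0 : 0 < rho by apply: le_lt_trans zr; exact: normc_ge0.
have [c1 c2] := gap_meanP r0 Nr.
set c := gap_mean rho z r in c1 c2 *; have A0 : 0 < disk_gap rho z.
  by rewrite disk_gap_gt0// ltW.
have AE : rho ^+ 2 = disk_gap rho z + normc z ^+ 2 by rewrite /disk_gap subrK.
rewrite /hyp; move: A0 AE; set A := disk_gap rho z => A0 AE cE.
have N0 := normc_ge0 z; move: AE cE c1 N0; set N := normc z => AE cE c1 N0.
have c0 : 0 < c by apply: le_lt_trans c1; rewrite mulr_ge0// ltW.
have r20 : 0 < r ^+ 2 by rewrite exprn_gt0.
have cA : c <= A.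
  rewrite -subr_ge0 (_ : A - c = r ^+ 2 + (r * N) ^+ 2 / c); last first.
    by move: cE => /eqP; rewrite -subr_eq0 => /eqP h; lra.
  by rewrite addr_ge0 ?sqr_ge0// divr_ge0 ?sqr_ge0// ltW.
have h1 : (r * N) ^+ 2 / A <= (r * N) ^+ 2 / c.
  by rewrite ler_wpM2l ?sqr_ge0// lef_pV2 ?posrE.
have h2 : c / A <= 1 - r ^+ 2 * rho ^+ 2 / A ^+ 2.
  have -> : 1 - r ^+ 2 * rho ^+ 2 / A ^+ 2 = (A - r ^+ 2 - (r * N) ^+ 2 / A) / A.
    by rewrite AE; field; rewrite gt_eqF.
  apply: ler_wpM2r; first by rewrite invr_ge0 ltW.
  lra.
have h3 : ln c - ln A <= c / A - 1.
  by rewrite -ln_div ?posrE//; apply: ln_le_subr1; rewrite divr_gt0.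
rewrite expr_div_n.
rewrite (_ : 4 * _ = 4 / r ^+ 2 * (r ^+ 2 * rho ^+ 2 / A ^+ 2)); last first.
  by field; rewrite !gt_eqF.
by apply: ler_wpM2l; [rewrite divr_ge0// ltW|lra].
Qed.

(** Conversely ln(A/c) <= A/c - 1 = (r^2 + (r|z|)^2/c)/c, and c >= A - K r^2;
    the resulting bound G r tends to 4 rho^2/A^2. *)
Lemma lower_laplacian_hyp_le rho z : normc z < rho ->
  (lower_laplacian (fun w => ln (hyp rho w)) z <= (4 * hyp rho z ^+ 2)%:E)%E.
Proof.
move=> zr; have rho0 : 0 < rho by apply: le_lt_trans zr; exact: normc_ge0.
have A0 : 0 < disk_gap rho z by rewrite disk_gap_gt0// ltW.
have AE : rho ^+ 2 = disk_gap rho z + normc z ^+ 2 by rewrite /disk_gap subrK.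
have N0 := normc_ge0 z.
pose A := disk_gap rho z; pose N := normc z.
(* For r^2 < A/2 one has c >= A/4, so (r N)^2/c <= 4 r^2 N^2/A. *)
pose K := 1 + 4 * N ^+ 2 / A.
pose G r := 4 * ((1 + N ^+ 2 / (A - K * r ^+ 2)) / (A - K * r ^+ 2)).
have cG : G r @[r --> (0 : R)^'+] --> 4 * hyp rho z ^+ 2.
  have -> : 4 * hyp rho z ^+ 2 = G 0.
    rewrite /G expr0n /= mulr0 subr0 /hyp expr_div_n AE -/A -/N.
    by field; rewrite gt_eqF.
  apply: cvg_at_right_filter.
  have cA : A - K * r ^+ 2 @[r --> (0 : R)] --> A - K * 0 ^+ 2.
    apply: cvgB; first exact: cvg_cst.
    by apply: cvgM; [exact: cvg_cst|exact: exprn_continuous].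
  have nz : A - K * 0 ^+ 2 != 0 by rewrite expr0n /= mulr0 subr0 gt_eqF.
  apply: cvgM; first exact: cvg_cst.
  apply: cvgM; last exact: cvgV.
  apply: cvgD; first exact: cvg_cst.
  by apply: cvgM; [exact: cvg_cst|exact: cvgV].
apply/lee_addgt0Pr => e e0; rewrite -EFinD; apply: limf_einf_le.
have H := near_circle_in_disk zr.
have KK : 0 < K by rewrite ltr_pwDl// divr_ge0 ?mulr_ge0 ?sqr_ge0// ltW.
have cG' : \forall r \near (0 : R)^'+, G r <= 4 * hyp rho z ^+ 2 + e.
  by apply: (cvgr_le _ cG); rewrite ltrDl.
have sq0 : r ^+ 2 @[r --> (0 : R)^'+] --> (0 : R) ^+ 2.
  by apply: cvg_at_right_filter; exact: exprn_continuous.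
near=> r; have [r0 Nr] : 0 < r /\ normc z + r < rho by near: r.
rewrite hyp_quotient// lee_fin.
apply: (@le_trans _ _ (G r)); last by near: r.
have rA : r ^+ 2 < A / 2.
  near: r; apply: (cvgr_lt _ sq0); first by rewrite expr0n divr_gt0.
have rK : 0 < A - K * r ^+ 2.
  rewrite subr_gt0 mulrC -ltr_pdivlMr//; near: r.
  by apply: (cvgr_lt _ sq0); rewrite expr0n divr_gt0.
have [c1 c2] := gap_meanP r0 Nr.
set c := gap_mean rho z r in c1 c2 *; rewrite -/A -/N in c1 c2 * => cE.
have c0 : 0 < c by apply: le_lt_trans c1; rewrite mulr_ge0// ltW.
have r20 : 0 < r ^+ 2 by rewrite exprn_gt0.
have cK : A - K * r ^+ 2 <= c.
  have : (r * N) ^+ 2 / c <= (r * N) ^+ 2 / (A / 4).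
    apply: ler_wpM2l; first exact: sqr_ge0.
    have A4 : 0 < A / 4 by rewrite divr_gt0.
    by rewrite lef_pV2 ?posrE//; lra.
  have -> : (r * N) ^+ 2 / (A / 4) = 4 * N ^+ 2 / A * r ^+ 2.
    by field; rewrite gt_eqF.
  rewrite /K; lra.
have h3 : ln A - ln c <= A / c - 1.
  by rewrite -ln_div ?posrE//; apply: ln_le_subr1; rewrite divr_gt0.
apply: (@le_trans _ _ (4 / r ^+ 2 * (A / c - 1))).
  by apply: ler_wpM2l; first by rewrite divr_ge0// ltW.
have -> : 4 / r ^+ 2 * (A / c - 1) = 4 * ((1 + N ^+ 2 / c) / c).
  have -> : A = c + (r * N) ^+ 2 / c + r ^+ 2 by lra.
  by field; rewrite !gt_eqF.
rewrite /G ler_wpM2l//; apply: ler_pM.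
- by rewrite addr_ge0// divr_ge0 ?sqr_ge0// ltW.
- by rewrite invr_ge0 ltW.
- by rewrite lerD2l ler_wpM2l ?sqr_ge0// lef_pV2 ?posrE.
- by rewrite lef_pV2 ?posrE.
Unshelve. all: by end_near. Qed.

(** The product of m with the reciprocal of hyp rho vanishes on |z| = rho and is
    therefore at most 1 inside, by the maximum principle; then let rho tend
    to 1. *)
Theorem ahlfors m : SK_metric unit_disk m ->
  forall z, unit_disk z -> m z <= hyperbolic_density z.
Proof.
move=> SKm z zD; have [[cm m0 _] _] := SKm.
have key rho : normc z < rho -> rho < 1 -> m z <= hyp rho z.
  move=> zr r1; have rho0 : 0 < rho by apply: le_lt_trans zr; exact: normc_ge0.
  have := @SK_max_principle R m (fun w => ln (hyp rho w))
    (fun w => m w * (disk_gap rho w / rho)) rho 1 SKm r1.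
  have inD w : normc w <= rho -> unit_disk w by move=> h; apply: le_lt_trans r1.
  move=> /(_ _ _ _ _ (ltW zr)) H.
  rewrite -[hyp rho z]mul1r -ler_pdivrMr ?hyp_gt0// /hyp invf_div; apply: H => //.
  - apply: continuous_in_subspaceT => w; rewrite inE /= => wr.
    apply: (@cvgM _ _ (nbhs w) (nbhs_filter w)).
      by apply: disk_continuous => //; exact: inD.
    apply: (@cvgM _ _ (nbhs w) (nbhs_filter w)); first exact: continuous_disk_gap.
    exact: (@cvg_cst _ _ _ (nbhs w) (nbhs_filter w)).
  - by move=> w wr; rewrite /disk_gap wr subrr mul0r mulr0.
  - move=> w wr; have wg : 0 < disk_gap rho w by rewrite disk_gap_gt0// ltW.
    have hE x : normc x < rho -> disk_gap rho x / rho = (hyp rho x)^-1.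
      by move=> _; rewrite invf_div.
    rewrite hE// ltr_pdivlMr ?hyp_gt0// mul1r => hm.
    split.
    + by apply: lt_trans hm; exact: hyp_gt0.
    + exact: near_continuous_ln_hyp.
    + apply: filterS (near_disk wr) => x xr.
      by rewrite expRN lnK ?posrE ?hyp_gt0// hE.
    + apply: le_lt_trans (lower_laplacian_hyp_le wr) _.
      rewrite lte_fin ltr_pM2l// ltr_pXn2r// nnegrE ltW ?hyp_gt0//.
      by apply: lt_trans hm; exact: hyp_gt0.
rewrite -hyp1.
have cH : hyp rho z @[rho --> (1 : R)] --> hyp 1 z.
  apply: cvgM; first exact: cvg_id.
  apply: cvgV; first by rewrite gt_eqF// disk_gap_gt0.
  by apply: cvgB; [exact: exprn_continuous|exact: cvg_cst].
have cH' : hyp rho z @[rho --> (1 : R)^'-] --> hyp 1 z by exact: cvg_at_left_filter.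
rewrite -(cvg_lim _ cH')//; apply: limr_ge; first by apply/cvg_ex; exists (hyp 1 z).
near=> rho; apply: key; first by near: rho; exact: nbhs_left_gt.
by near: rho; exact: nbhs_left_lt.
Unshelve. all: by end_near. Qed.

End hyperbolic_metric.

(** * The Green function of the disk *)

Section green_function.
Context {R : realType}.
Implicit Types (z w a : cplx R) (r : R).
Notation mu := (@lebesgue_measure R).

Definition blaschke_modulus a z : R := normc (z - a) / normc (1 - (a^*)%C * z).

(** Extended valued: the pole has the value +oo, and sums of Green functions make
    sense everywhere in the disk. *)
Definition green a z : \bar R := (- lne (blaschke_modulus a z)%:E)%E.

Lemma sqr_normc_1B_conjM a z :
  normc (1 - (a^*)%C * z) ^+ 2 =
  normc (z - a) ^+ 2 + disk_gap 1 a * disk_gap 1 z.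
Proof.
rewrite /disk_gap !sqr_normc_ReIm.
by case: a z => a1 a2 [z1 z2] /=; ring.
Qed.

Lemma normc_1B_conjM_gt0 a z : normc a < 1 -> normc z < 1 ->
  0 < normc (1 - (a^*)%C * z).
Proof.
move=> a1 z1; rewrite normc_gt0 -normc_eq0 -sqrf_eq0 sqr_normc_1B_conjM gt_eqF//.
by rewrite ltr_wpDl ?sqr_ge0// mulr_gt0 ?disk_gap_gt0.
Qed.

Lemma blaschke_modulus_ge0 a z : 0 <= blaschke_modulus a z.
Proof. by rewrite divr_ge0 ?normc_ge0. Qed.

Lemma blaschke_modulus_gt0 a z : normc a < 1 -> normc z < 1 ->
  (0 < blaschke_modulus a z) = (z != a).
Proof.
move=> a1 z1; rewrite lt_def blaschke_modulus_ge0 andbT.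
rewrite mulf_eq0 invr_eq0 (gt_eqF (normc_1B_conjM_gt0 a1 z1)) orbF.
by rewrite normc_eq0 subr_eq0.
Qed.

Lemma blaschke_modulus_lt1 a z : normc a < 1 -> normc z < 1 ->
  blaschke_modulus a z < 1.
Proof.
move=> a1 z1; have n0 := normc_1B_conjM_gt0 a1 z1.
rewrite ltr_pdivrMr// mul1r -(ltr_pXn2r (n:=2)) ?nnegrE ?normc_ge0//.
by rewrite sqr_normc_1B_conjM ltrDl mulr_gt0 ?disk_gap_gt0.
Qed.

Lemma green_ge0 a z : normc a < 1 -> normc z < 1 -> (0 <= green a z)%E.
Proof.
by move=> a1 z1; rewrite oppe_ge0 lne_le0 lee_fin ltW// blaschke_modulus_lt1.
Qed.

Lemma green_fin a z : normc a < 1 -> normc z < 1 -> z != a ->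
  green a z = (- ln (blaschke_modulus a z))%:E.
Proof. by move=> a1 z1 za; rewrite /green lne_EFin// blaschke_modulus_gt0. Qed.

Lemma green_pole a : green a a = +oo%E.
Proof. by rewrite /green /blaschke_modulus subrr normc0 mul0r le0_lneNy. Qed.

(** -2 ln b <= 1/b^2 - 1 = (1-|a|^2)(1-|z|^2)/|z-a|^2 for the modulus b of the
    Blaschke factor. *)
Lemma green_le a z : normc a < 1 -> normc z < 1 -> z != a ->
  - ln (blaschke_modulus a z) <= (1 - normc a) / normc (z - a) ^+ 2.
Proof.
move=> a1 z1 za; have b0 : 0 < blaschke_modulus a z by rewrite blaschke_modulus_gt0.
have za0 : 0 < normc (z - a) by rewrite normc_gt0 subr_eq0.
have n0 := normc_1B_conjM_gt0 a1 z1.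
have bE : (blaschke_modulus a z ^+ 2)^-1 =
    1 + disk_gap 1 a * disk_gap 1 z / normc (z - a) ^+ 2.
  rewrite /blaschke_modulus expr_div_n invf_div sqr_normc_1B_conjM.
  by field; rewrite gt_eqF.
have := @ln_le_subr1 R (blaschke_modulus a z ^+ 2)^-1.
rewrite invr_gt0 exprn_gt0// => /(_ isT).
rewrite lnV ?posrE ?exprn_gt0// lnXn// (mulr2n (ln _)) bE addrAC subrr add0r => h.
have h2 : disk_gap 1 a * disk_gap 1 z / normc (z - a) ^+ 2 <=
   2 * ((1 - normc a) / normc (z - a) ^+ 2).
  rewrite mulrA; apply: ler_wpM2r; first by rewrite invr_ge0 sqr_ge0.
  rewrite /disk_gap !expr1n; have := normc_ge0 a; have := normc_ge0 z.
  move: (normc a) (normc z) a1 z1 => x y x1 y1 y0 x0.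
  have -> : (1 - x ^+ 2) * (1 - y ^+ 2) = (1 - x) * ((1 + x) * (1 - y ^+ 2)).
    by ring.
  rewrite [leRHS]mulrC; apply: ler_wpM2l; first by rewrite subr_ge0 ltW.
  have y20 := sqr_ge0 y; nra.
lra.
Qed.

Lemma continuous_ln_affine (k m : cplx R) : (forall t, k + m * expi t != 0) ->
  continuous (fun t => ln (normc (k + m * expi t))).
Proof.
move=> h t; apply: (@continuous_comp _ _ _ (fun t => normc (k + m * expi t)) (@ln R)).
  have -> : (fun t => normc (k + m * expi t)) =
      (fun x => normc (x - (- k))) \o (fun t => m * expi t).
    by apply/funext => x /=; rewrite opprK addrC.
  apply: continuous_comp; first exact: continuous_mul_expi.
  exact: continuous_normc_dist.
by apply: continuous_ln; rewrite normc_gt0.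
Qed.

(** The denominator 1 - conj(a) w has no zero in the disk, so its logarithm has
    the mean value property; whether a lies inside or outside the circle matters
    for the numerator only. *)
Lemma circle_integral_ln_blaschke a z r : normc a < 1 -> 0 < r ->
  normc z + r < 1 -> (forall t, circle_point z r t != a) ->
  circle_integral (fun w => ln (blaschke_modulus a w)) z r =
  \int[mu]_(t in `[0, 2 * pi]) ln (normc (z - a + r%:C * expi t)) -
  2 * pi * ln (normc (1 - (a^*)%C * z)).
Proof.
move=> a1 r0 zr c_ne.
have cr t : normc (circle_point z r t) < 1.
  by apply: le_lt_trans zr; apply: le_normc_circle_point; exact: ltW.
have z1 : normc z < 1 by apply: le_lt_trans zr; rewrite lerDl ltW.
have numE t : circle_point z r t - a = z - a + r%:C * expi t.
  by rewrite circle_point_expi addrAC.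
have denE t : 1 - (a^*)%C * circle_point z r t =
    1 - (a^*)%C * z + - ((a^*)%C * r%:C) * expi t.
  by rewrite circle_point_expi mulrDr opprD mulNr mulrA addrA.
transitivity (\int[mu]_(t in `[0, 2 * pi])
   (ln (normc (z - a + r%:C * expi t)) -
    ln (normc (1 - (a^*)%C * z + - ((a^*)%C * r%:C) * expi t)))).
  apply: eq_Rintegral => t _; rewrite -numE -denE.
  rewrite ln_div ?posrE ?normc_gt0 ?subr_eq0//.
  by rewrite -subr_eq0 -normc_gt0 normc_1B_conjM_gt0.
rewrite RintegralB//; last 2 first.
- apply: continuous_integrable; apply: continuous_ln_affine => t.
  by rewrite -numE subr_eq0.
- apply: continuous_integrable; apply: continuous_ln_affine => t.
  by rewrite -denE -normc_gt0 normc_1B_conjM_gt0.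
rewrite [X in _ - X]mean_ln_affine//.
rewrite normcN normcM normc_conj normc_real gtr0_norm//.
have h := ler_normcB (1 : cplx R) ((a^*)%C * z).
apply: lt_le_trans h; rewrite normc1 normcM normc_conj.
have a0 := normc_ge0 a; have z0 := normc_ge0 z; nra.
Qed.

Lemma ln_blaschke_mean_value a z r : normc a < 1 -> 0 < r ->
  normc z + r < 1 -> r < normc (z - a) ->
  circle_integral (fun w => ln (blaschke_modulus a w)) z r =
  2 * pi * ln (blaschke_modulus a z).
Proof.
move=> a1 r0 zr rza; rewrite circle_integral_ln_blaschke//; last first.
  move=> t; apply: contraTN rza => /eqP <-.
  by rewrite normc_distC normc_circle_point ?ltxx// ltW.
rewrite mean_ln_affine; last by rewrite normc_real gtr0_norm.
have z1 : normc z < 1 by apply: le_lt_trans zr; rewrite lerDl ltW.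
rewrite -mulrBr -ln_div// ?posrE ?normc_1B_conjM_gt0//.
by apply: lt_trans rza.
Qed.

(** In other words, the circle mean about 0 of the Green function with pole a is
    the smaller one of -ln|a| and -ln r. *)
Lemma ln_blaschke_circle_mean a r : normc a < 1 -> 0 < r < 1 -> normc a != r ->
  circle_integral (fun w => ln (blaschke_modulus a w)) 0 r =
  2 * pi * ln (Num.max (normc a) r).
Proof.
move=> a1 /andP[r0 r1] ar.
rewrite circle_integral_ln_blaschke// ?normc0 ?add0r//; last first.
  by move=> t; apply: contra ar => /eqP <-; rewrite normc_circle_point0 ?ltW.
rewrite mulr0 subr0 normc1 ln1 mulr0 subr0.
move: ar; rewrite neq_lt => /orP[ar|ra].
  rewrite mean_ln_affine_gt ?normcN ?normc_real ?gtr0_norm//.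
  by rewrite max_r// ltW.
by rewrite mean_ln_affine ?normcN ?normc_real ?gtr0_norm// max_l// ltW.
Qed.

Lemma continuous_blaschke_modulus a z : normc a < 1 -> normc z < 1 ->
  {for z, continuous (blaschke_modulus a)}.
Proof.
move=> a1 z1; pose FF := @nbhs_filter _ z.
apply: (@cvgM _ _ (nbhs z) FF); first exact: continuous_normc_dist.
apply: (@cvgV _ _ (nbhs z) FF).
  by rewrite gt_eqF// normc_1B_conjM_gt0.
apply: (@continuous_comp _ _ _ (fun x : cplx R => (1 - (a^*)%C * x : cplx R))).
  apply: (@cvgB _ _ _ (nbhs z) FF); first exact: (@cvg_cst _ _ _ (nbhs z) FF).
  apply: (@cvgM _ _ (nbhs z) FF); first exact: (@cvg_cst _ _ _ (nbhs z) FF).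
  exact: cvg_id.
exact: continuous_normc.
Qed.

Lemma continuous_ln_blaschke a z : normc a < 1 -> normc z < 1 -> z != a ->
  {for z, continuous (fun w => ln (blaschke_modulus a w))}.
Proof.
move=> a1 z1 za; apply: (@continuous_comp _ _ _ (blaschke_modulus a) (@ln R)).
  exact: continuous_blaschke_modulus.
by apply: continuous_ln; rewrite blaschke_modulus_gt0.
Qed.

End green_function.

(** * Sums of Green functions over a Blaschke sequence *)

Section blaschke_sequences.
Context {R : realType} (I : set nat) (a : nat -> cplx R).
Hypothesis hC : finite_or_Blaschke I a.
Implicit Types (z w : cplx R) (r : R).
Notation mu := (@lebesgue_measure R).

Lemma seq_in_disk j : j \in I -> normc (a j) < 1.
Proof. by case: hC => h _; rewrite inE => /h. Qed.

Let gap j : \bar R := (1 - normc (a j))%:E.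

Let gap_ge0 j : j \in I -> (0 <= gap j)%E.
Proof. by move=> /seq_in_disk h; rewrite lee_fin subr_ge0 ltW. Qed.

(** This treats finite sequences and Blaschke sequences alike from here on. *)
Lemma blaschke_condition : (\sum_(0 <= j <oo | j \in I) gap j < +oo)%E.
Proof.
case: (hC) => _ [[n In]|[IT hs]].
  rewrite (nneseries_split_cond 0%N n)//.
  rewrite [X in (_ + X)%E]eseries0; last first.
    by move=> j; rewrite add0n In => nj; rewrite inE /= ltnNge nj.
  by rewrite adde0 sumEFin ltry.
by rewrite IT; under eq_eseriesl do rewrite in_setT.
Qed.

Lemma blaschke_tail (e : R) : 0 < e ->
  exists N, (\sum_(N <= j <oo | j \in I) gap j < e%:E)%E.
Proof.
move=> e0; have := nneseries_tail_cvg blaschke_condition gap_ge0.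
move=> /fine_cvgP[fin /(cvgr_lt _)/(_ _ e0) lt].
have [N [Nfin Nlt]] := filter_ex (filterI fin lt).
by exists N; rewrite -(fineK Nfin) lte_fin.
Qed.

Lemma blaschke_term_tail N j : (N <= j)%N -> j \in I ->
  (gap j <= \sum_(N <= j <oo | j \in I) gap j)%E.
Proof.
move=> Nj jI; apply: le_trans (nneseries_lim_ge j.+1 _); last first.
  by move=> n _; exact: gap_ge0.
rewrite big_mkcond big_nat_recr//= jI leeDr// sume_ge0// => i _.
by case: ifP => // /gap_ge0.
Qed.

Lemma finite_min_gt0 (d : nat -> R) (P : pred nat) N :
  (forall j, (j < N)%N -> P j -> 0 < d j) ->
  exists2 e, 0 < e & forall j, (j < N)%N -> P j -> e <= d j.
Proof.
elim: N => [_|N ih dP]; first by exists 1.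
have [|e e0 eP] := ih; first by move=> j jN; apply: dP; exact: ltnW.
have [PN|PN] := boolP (P N); last first.
  exists e => // j; rewrite ltnS leq_eqVlt => /predU1P[-> /(negP PN)//|].
  exact: eP.
exists (Num.min e (d N)); first by rewrite lt_min e0 dP.
move=> j; rewrite ltnS leq_eqVlt => /predU1P[-> _|jN Pj].
  by rewrite ge_min lexx orbT.
by rewrite ge_min eP.
Qed.

(** By the Blaschke condition all but finitely many points are close to the unit
    circle, hence far from z; the others different from z have a least distance
    to z. *)
Lemma seq_locally_finite z : unit_disk z -> exists2 d, 0 < d &
  forall w, normc (w - z) < d -> normc w < 1 /\
    forall j, j \in I -> a j != z -> d <= normc (w - a j).
Proof.
move=> zD; have e0 : 0 < (1 - normc z) / 2 by rewrite divr_gt0 ?subr_gt0.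
have [N tailN] := blaschke_tail e0.
have [|e1 e10 He1] := @finite_min_gt0 (fun j => normc (z - a j))
    [pred j | (j \in I) && (a j != z)] N.
  by move=> j _ /andP[_ ajz]; rewrite normc_gt0 subr_eq0 eq_sym.
(* The distances are from z; the halving pays for the move from z to w. *)
pose d := Num.min e1 ((1 - normc z) / 2) / 2.
have d0 : 0 < d by rewrite divr_gt0// lt_min e10 e0.
exists d => // w wz.
have d1 : d <= e1 / 2 by rewrite ler_pM2r ?invr_gt0// ge_min lexx.
have d2 : d <= (1 - normc z) / 2 / 2 by rewrite ler_pM2r ?invr_gt0// ge_min lexx orbT.
split.
  have := ler_normcB w z; move: zD; rewrite /unit_disk /= => zD; lra.
move=> j jI ajz.
have zwa : normc (z - a j) <= normc (w - z) + normc (w - a j).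
  apply: le_trans (_ : normc ((z - w) + (w - a j)) <= _).
    by rewrite addrA subrK.
  by apply: le_trans (le_normcD _ _) _; rewrite (normc_distC z).
suff : 2 * d <= normc (z - a j) by lra.
have [jN|Nj] := ltnP j N.
  by have := He1 j jN; rewrite /= jI ajz => /(_ isT); lra.
have := le_lt_trans (blaschke_term_tail Nj jI) tailN.
rewrite lte_fin; have := ler_normcB (a j) z; rewrite (normc_distC (a j)).
lra.
Qed.

Definition blaschke_green z : \bar R := (\sum_(0 <= j <oo | j \in I) green (a j) z)%E.

(** The modulus of the Blaschke product, written as the exponential of minus the
    sum of the Green functions. As expeR sends -oo to 0, it vanishes on the
    sequence. *)
Definition blaschke_product z : R := fine (expeR (- blaschke_green z)).

Lemma blaschke_green_ge0 z : normc z < 1 -> (0 <= blaschke_green z)%E.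
Proof.
by move=> z1; apply: nneseries_ge0 => j _ jI; apply: green_ge0 => //; exact: seq_in_disk.
Qed.

Lemma blaschke_product_ge0 z : 0 <= blaschke_product z.
Proof. by rewrite fine_ge0// expeR_ge0. Qed.

Lemma blaschke_product_le1 z : normc z < 1 -> blaschke_product z <= 1.
Proof.
move=> z1; rewrite /blaschke_product; have := blaschke_green_ge0 z1.
case: blaschke_green => [s| |]//=; rewrite lee_fin => s0.
by rewrite -expR0 ler_expR lerNl oppr0.
Qed.

Lemma off_seqP z : ~ seq_points I a z -> forall j, j \in I -> z != a j.
Proof.
move=> nz j jI; apply/eqP => zj; apply: nz; exists j => //; exact/set_mem.
Qed.

(** Near a point off the sequence, the distance to all points of the sequence is
    bounded below, so the series of Green functions is dominated by the series
    of the 1 - |a_j|. *)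
Lemma blaschke_green_dominated z : unit_disk z -> ~ seq_points I a z ->
  exists2 d, 0 < d & forall w, normc (w - z) < d -> [/\ normc w < 1,
    forall j, j \in I -> d <= normc (w - a j) &
    forall j, j \in I -> (green (a j) w <= (d ^- 2)%:E * gap j)%E].
Proof.
move=> zD nz; have [d d0 dP] := seq_locally_finite zD.
exists d => // w /dP[w1 wa].
have wa' j : j \in I -> d <= normc (w - a j).
  by move=> jI; apply: wa => //; rewrite eq_sym off_seqP.
split=> // j jI; have ja := wa' j jI.
have wne : w != a j.
  by rewrite -subr_eq0 -normc_gt0; apply: lt_le_trans ja.
have aj1 := seq_in_disk jI.
rewrite green_fin// -EFinM lee_fin; apply: le_trans (green_le aj1 w1 wne) _.
rewrite mulrC; apply: ler_wpM2r; first by rewrite subr_ge0 ltW.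
rewrite lef_pV2 ?posrE ?exprn_gt0 ?(lt_le_trans d0)//.
by rewrite ler_pXn2r// nnegrE ?normc_ge0// ltW.
Qed.

Lemma blaschke_green_fin z : unit_disk z -> ~ seq_points I a z ->
  blaschke_green z \is a fin_num.
Proof.
move=> zD nz; have [d d0 dP] := blaschke_green_dominated zD nz.
have [|z1 _ gz] := dP z; first by rewrite subrr normc0.
rewrite ge0_fin_numE ?blaschke_green_ge0//.
apply: (@le_lt_trans _ _ (\sum_(0 <= j <oo | j \in I) ((d ^- 2)%:E * gap j))%E).
  apply: lee_nneseries => // j _ jI; apply: green_ge0 => //; exact: seq_in_disk.
rewrite nneseriesZl//; last first.
have := blaschke_condition.
have : (0 <= \sum_(0 <= j <oo | j \in I) gap j)%E.
  by apply: nneseries_ge0 => j _; exact: gap_ge0.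
case: (limn _) => // s _ _; by rewrite -EFinM ltry.
Qed.

Lemma near_off_seq z : unit_disk z -> ~ seq_points I a z ->
  \forall w \near z, unit_disk w /\ ~ seq_points I a w.
Proof.
move=> zD nz; have [d d0 dP] := blaschke_green_dominated zD nz.
apply/nbhs_normcP; exists d => // w /dP[w1 wa _]; split=> // -[j jI ajw].
by have := wa j (mem_set jI); rewrite ajw subrr normc0 leNgt d0.
Qed.

Definition green_partial_sum N z : R :=
  \sum_(0 <= j < N | j \in I) - ln (blaschke_modulus (a j) z).

Lemma continuous_green_partial_sum N z : unit_disk z -> ~ seq_points I a z ->
  {for z, continuous (green_partial_sum N)}.
Proof.
move=> zD nz; rewrite /green_partial_sum.
elim: N => [|N ih].
  rewrite (_ : (fun _ => _) = cst 0); first exact: cst_continuous.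
  by apply/funext => w; rewrite big_geq.
rewrite (_ : (fun _ => _) = fun w =>
    \sum_(0 <= j < N | j \in I) - ln (blaschke_modulus (a j) w) +
    if N \in I then - ln (blaschke_modulus (a N) w) else 0); last first.
  by apply/funext => w; rewrite big_mkcond big_nat_recr//= -big_mkcond.
apply: (@cvgD _ _ _ (nbhs z) (nbhs_filter z)); first exact: ih.
have [NI|_] := boolP (N \in I); last exact: (@cvg_cst _ _ _ (nbhs z) (nbhs_filter z)).
apply: (@cvgN _ _ _ (nbhs z) (nbhs_filter z)).
by apply: continuous_ln_blaschke => //; [exact: seq_in_disk|exact: off_seqP].
Qed.

(** By domination the tails are uniformly small near z; this transfers continuity
    from the partial sums to the sum. *)
Lemma blaschke_green_partial z : unit_disk z -> ~ seq_points I a z ->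
  forall e, 0 < e -> exists N, \forall w \near z,
    0 <= fine (blaschke_green w) - green_partial_sum N w < e.
Proof.
move=> zD nz e e0; have [d d0 dP] := blaschke_green_dominated zD nz.
have ed0 : 0 < e * d ^+ 2 by rewrite mulr_gt0// exprn_gt0.
have [N tailN] := blaschke_tail ed0; exists N.
have near_d : \forall w \near z, normc (w - z) < d.
  by apply/nbhs_normcP; exists d.
apply: filterS (filterI near_d (near_off_seq zD nz)) => w [/dP[w1 wa gw] [wD nw]].
have SE : blaschke_green w = ((green_partial_sum N w)%:E +
    \sum_(N <= j <oo | j \in I) green (a j) w)%E.
  rewrite /blaschke_green (nneseries_split_cond 0%N N); last first.
    by move=> j jI; apply: green_ge0 => //; exact: seq_in_disk.
  rewrite add0n; congr (_ + _)%E; rewrite /green_partial_sum -sumEFin.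
  by apply: eq_bigr => j jI; rewrite green_fin//; [exact: seq_in_disk|exact: off_seqP].
have T0 : (0 <= \sum_(N <= j <oo | j \in I) green (a j) w)%E.
  by apply: nneseries_ge0 => j _ jI; apply: green_ge0 => //; exact: seq_in_disk.
have Te : (\sum_(N <= j <oo | j \in I) green (a j) w < e%:E)%E.
  apply: (@le_lt_trans _ _ (\sum_(N <= j <oo | j \in I) ((d ^- 2)%:E * gap j))%E).
    apply: lee_nneseries => // j _ jI; apply: green_ge0 => //; exact: seq_in_disk.
  rewrite nneseriesZl//.
  apply: (@lt_le_trans _ _ ((d ^- 2)%:E * (e * d ^+ 2)%:E)%E).
    by rewrite lte_pmul2l// lte_fin invr_gt0 exprn_gt0.
  by rewrite -EFinM lee_fin mulrCA mulVf ?mulr1// gt_eqF// exprn_gt0.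
move: SE T0 Te; set T := limn _ => SE T0 Te.
have Tfin : T \is a fin_num by rewrite ge0_fin_numE// (lt_trans Te)// ltry.
rewrite SE -(fineK Tfin) -EFinD /= addrAC subrr add0r.
by rewrite fine_ge0//= -lte_fin fineK.
Qed.

Lemma continuous_blaschke_green z : unit_disk z -> ~ seq_points I a z ->
  {for z, continuous (fun w => fine (blaschke_green w))}.
Proof.
move=> zD nz; apply/(@cvgrPdist_lt _ _ _ _ (nbhs_filter z)) => e e0.
have e30 : 0 < e / 3 by rewrite divr_gt0.
have [N nearN] := blaschke_green_partial zD nz e30.
have := continuous_green_partial_sum (N := N) zD nz.
move=> /(@cvgrPdist_lt _ _ _ _ (nbhs_filter z))/(_ _ e30) nearP.
apply: filterS (filterI nearN nearP) => w [/andP[w1 w2]].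
have /andP[z1 z2] := nbhs_singleton nearN.
by rewrite !ltr_norml => /andP[h1 h2]; apply/andP; split; lra.
Qed.

(** All terms have the mean value property on the same small circles about z,
    because a neighbourhood of z contains no pole; monotone convergence sums the
    integrals. *)
Lemma blaschke_green_mean_value z : unit_disk z -> ~ seq_points I a z ->
  mean_value_at (fun w => fine (blaschke_green w)) z.
Proof.
move=> zD nz; have [d d0 dP] := blaschke_green_dominated zD nz.
near=> r; have r0 : 0 < r by near: r; exact: nbhs_right_gt.
have rd : r < d by near: r; exact: nbhs_right_lt.
have rz : normc z + r < 1.
  by rewrite -ltrBrDl; near: r; apply: nbhs_right_lt; rewrite subr_gt0.
have cD t : unit_disk (circle_point z r t).
  by apply: le_lt_trans rz; apply: le_normc_circle_point; exact: ltW.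
have cd t : normc (circle_point z r t - z) < d.
  by rewrite normc_circle_point ?ltW.
have cn t : ~ seq_points I a (circle_point z r t).
  move=> [j jI ajw]; have [_ wa _] := dP _ (cd t).
  by have := wa j (mem_set jI); rewrite ajw subrr normc0 leNgt d0.
have z_d : normc (z - z) < d by rewrite subrr normc0.
rewrite /circle_integral /Rintegral.
pose f j t := if j \in I then green (a j) (circle_point z r t) else 0%E.
have fE j t : j \in I -> f j t = (- ln (blaschke_modulus (a j) (circle_point z r t)))%:E.
  by move=> jI; rewrite /f jI green_fin//; [exact: seq_in_disk|exact: cD|exact: off_seqP].
have cln0 j : j \in I ->
    continuous (fun t => ln (blaschke_modulus (a j) (circle_point z r t))).
  move=> jI t.
  apply: (@continuous_comp _ _ _ _ (fun w => ln (blaschke_modulus (a j) w))).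
    exact: continuous_circle_point.
  by apply: continuous_ln_blaschke; [exact: seq_in_disk|exact: cD|exact: off_seqP].
have cln j : j \in I ->
    continuous (fun t => - ln (blaschke_modulus (a j) (circle_point z r t))).
  by move=> jI t; apply: cvgN; exact: cln0.
transitivity (fine (\int[mu]_(t in `[0%R, (2 * pi)%R]) (\sum_(0 <= j <oo) f j t)%E)).
  congr fine; apply: eq_integral => t _.
  by rewrite fineK ?blaschke_green_fin// /blaschke_green eseries_mkcond.
rewrite (@integral_nneseries _ _ R mu _ (measurable_itv _) f)//; last 2 first.
- move=> j; have [jI|jI] := boolP (j \in I); last first.
    by rewrite (_ : f j = cst 0%E)//; apply/funext => t; rewrite /f (negbTE jI).
  rewrite (_ : f j = EFin \o (fun t => - ln (blaschke_modulus (a j) (circle_point z r t)))).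
    apply/measurable_EFinP; apply: measurable_funTS.
    by apply: continuous_measurable_fun; exact: cln.
  by apply/funext => t; rewrite fE.
- move=> j t _; rewrite /f; case: ifPn => // jI.
  by apply: green_ge0; [exact: seq_in_disk|exact: cD].
rewrite (_ : (\sum_(0 <= j <oo) _)%E = ((2 * pi)%:E * blaschke_green z)%E); last first.
  rewrite -nneseriesZl; last first.
    by move=> j jI; apply: green_ge0 => //; exact: seq_in_disk.
  rewrite [RHS]eseries_mkcond; apply: eq_eseriesr => j _; case: ifPn => jI; last first.
    by rewrite /f (negbTE jI) integral0.
  under eq_integral do rewrite fE//.
  have ne : z != a j by exact: off_seqP.
  rewrite (green_fin (seq_in_disk jI) zD ne).
  have := ln_blaschke_mean_value (seq_in_disk jI) r0 rz.
  have [_ /(_ _ jI) za _] := dP _ z_d; move=> /(_ (lt_le_trans rd za)) mv.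
  rewrite -EFinM mulrN -mv -mulN1r /circle_integral.
  rewrite -RintegralZl//; last first.
    by apply: continuous_integrable; exact: cln0.
  rewrite -[LHS]fineK.
    by congr EFin; apply: eq_Rintegral => t _; rewrite mulN1r.
  apply: integrable_fin_num => //.
  exact: (continuous_integrable _ _ (cln _ jI)).
rewrite -(fineK (blaschke_green_fin zD nz)) -EFinM /=.
by [].
Unshelve. all: by end_near. Qed.

End blaschke_sequences.

(** * The modulus of the Blaschke product *)

Section blaschke_product.
Context {R : realType} (I : set nat) (a : nat -> cplx R).
Hypothesis hC : finite_or_Blaschke I a.
Implicit Types (z w : cplx R) (r : R).
Notation mu := (@lebesgue_measure R).
Notation B := (blaschke_product I a).
Notation S := (blaschke_green I a).

Lemma blaschke_product_off z : unit_disk z -> ~ seq_points I a z ->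
  B z = expR (- fine (S z)).
Proof.
move=> zD nz; rewrite /blaschke_product.
by rewrite -(fineK (blaschke_green_fin hC zD nz)).
Qed.

Lemma blaschke_product_gt0 z : unit_disk z -> ~ seq_points I a z -> 0 < B z.
Proof. by move=> zD nz; rewrite blaschke_product_off// expR_gt0. Qed.

Lemma ln_blaschke_product z : unit_disk z -> ~ seq_points I a z ->
  ln (B z) = - fine (S z).
Proof. by move=> zD nz; rewrite blaschke_product_off// expRK. Qed.

(** To be used with the n indices at which the sequence takes the value w. *)
Lemma blaschke_product_le z w n : unit_disk z -> unit_disk w -> z != w ->
  (\sum_(i < n) green w z <= S z)%E -> B z <= blaschke_modulus w z ^+ n.
Proof.
move=> zD wD zw.
have b0 : 0 < blaschke_modulus w z by rewrite blaschke_modulus_gt0.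
rewrite green_fin// sumEFin sumr_const card_ord /blaschke_product.
case: (S z) => [s| |] //=; last by rewrite exprn_ge0// ltW.
rewrite lee_fin => h; rewrite -[leRHS]lnK ?posrE ?exprn_gt0// ler_expR lnXn//.
by rewrite lerNl -mulNrn.
Qed.

Lemma blaschke_product_le_factor z j : unit_disk z -> j \in I ->
  B z <= blaschke_modulus (a j) z.
Proof.
move=> zD jI; have aD := seq_in_disk hC jI.
have g0 i : i \in I -> (0 <= green (a i) z)%E.
  by move=> iI; apply: green_ge0 => //; exact: (seq_in_disk hC).
have [->|zj] := eqVneq z (a j).
  rewrite /blaschke_product (_ : S (a j) = +oo%E).
    by rewrite /= blaschke_modulus_ge0.
  apply: (@nneseries_pinfty _ _ _ j) => //; last exact: green_pole.
  by move=> i iI; apply: green_ge0 => //; exact: (seq_in_disk hC).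
rewrite -[leRHS]expr1; apply: blaschke_product_le => //.
rewrite big_ord1; have := @lee_sum_fset_lim R (fun i => green (a i) z) (fset1 j) (mem I) g0.
by rewrite big_mkcond big_seq_fset1 /= jI.
Qed.

Lemma blaschke_product_le_multiplicity z w : unit_disk z -> unit_disk w ->
  z != w -> B z <= blaschke_modulus w z ^+ multiplicity I a w.
Proof.
move=> zD wD zw; apply: blaschke_product_le => //.
have g0 i : i \in I -> (0 <= green (a i) z)%E.
  by move=> iI; apply: green_ge0 => //; exact: (seq_in_disk hC).
rewrite /multiplicity; set J := [set j | I j /\ a j = w].
apply: le_trans (@lee_sum_fset_lim R (fun i => green (a i) z) (fset_set J) (mem I) g0).
have memJ i : i \in fset_set J -> J i.
  have [finJ|ninfJ] := pselect (finite_set J); first by rewrite in_fset_set// inE.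
  by rewrite /fset_set; case: pselect.
rewrite (_ : (\sum_(i <- fset_set J | _) _)%E = (\sum_(i <- fset_set J) green w z)%E).
  by rewrite big_const_ord big_const_seq count_predT.
rewrite [LHS]big_seq_cond [RHS]big_seq; apply: eq_big => i.
  have [/memJ [Ii _]|//] := boolP (i \in fset_set J).
  by rewrite /= mem_set.
by move=> /andP[/memJ [_ ->]].
Qed.

Lemma blaschke_product_seq z : seq_points I a z -> B z = 0.
Proof.
move=> [j jI <-]; apply/eqP; rewrite eq_le blaschke_product_ge0 andbT.
have jI' := mem_set jI.
have := blaschke_product_le_factor (seq_in_disk hC jI') jI'.
by rewrite /blaschke_modulus subrr normc0 mul0r.
Qed.

Lemma blaschke_product_neq0 z : 0 < B z -> ~ seq_points I a z.
Proof. by move=> B0 /blaschke_product_seq B00; rewrite B00 ltxx in B0. Qed.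

Lemma continuous_blaschke_product z : unit_disk z -> {for z, continuous B}.
Proof.
move=> zD; have [[j jI ajz]|nz] := pselect (seq_points I a z); last first.
  have cE : {for z, continuous (fun w => expR (- fine (S w)))}.
    apply: (@continuous_comp _ _ _ (fun w => - fine (S w)) (@expR R)).
      apply: (@cvgN _ _ _ (nbhs z) (nbhs_filter z)).
      exact: continuous_blaschke_green.
    exact: continuous_expR.
  rewrite /prop_for /continuous_at blaschke_product_off//.
  apply: cvg_trans cE; apply: (@near_eq_cvg _ _ (nbhs z) (nbhs_filter z)).
  have : \forall w \near z, expR (- fine (S w)) = B w.
    apply: filterS (near_off_seq hC zD nz) => w [wD nw].
    by rewrite blaschke_product_off.
  exact.
have jI' := mem_set jI.
apply/(@cvgrPdist_lt _ _ _ _ (nbhs_filter z)) => e e0.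
rewrite blaschke_product_seq; last by exists j.
have cb := continuous_blaschke_modulus (seq_in_disk hC jI') zD.
move: cb => /(@cvgrPdist_lt _ _ _ _ (nbhs_filter z))/(_ _ e0).
have bz : blaschke_modulus (a j) z = 0.
  by rewrite /blaschke_modulus ajz subrr normc0 mul0r.
move=> H; apply: filterS (filterI H (near_disk zD)) => w [].
rewrite bz !sub0r !normrN ger0_norm ?blaschke_modulus_ge0// => bw wD.
rewrite ger0_norm ?blaschke_product_ge0//; apply: le_lt_trans bw.
exact: blaschke_product_le_factor.
Qed.

Lemma near_continuous_ln_blaschke_product z : unit_disk z -> ~ seq_points I a z ->
  \forall w \near z, {for w, continuous (fun x => ln (B x))}.
Proof.
move=> zD nz; apply: near_continuous_ln; last exact: blaschke_product_gt0.
by apply: filterS (near_disk zD) => w wD; exact: continuous_blaschke_product.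
Qed.

Lemma ln_blaschke_product_mean_value z : unit_disk z -> ~ seq_points I a z ->
  mean_value_at (fun w => ln (B w)) z.
Proof.
move=> zD nz; have mS := blaschke_green_mean_value hC zD nz.
have off := near_circle (near_off_seq hC zD nz).
have cS : \forall w \near z, {for w, continuous (fun w => fine (S w))}.
  apply: filterS (near_off_seq hC zD nz) => w [wD nw].
  exact: continuous_blaschke_green.
have cS' := near_circle_continuous cS.
near=> r; rewrite ln_blaschke_product// mulrN -mulN1r.
have <- : circle_integral (fun w => fine (S w)) z r = 2 * pi * fine (S z) by near: r.
rewrite /circle_integral -RintegralZl//; last first.
  by apply: continuous_integrable; near: r.
have off_r : forall t, unit_disk (circle_point z r t) /\
    ~ seq_points I a (circle_point z r t) by near: r.
by apply: eq_Rintegral => t _; rewrite mulN1r; case: (off_r t); exact: ln_blaschke_product.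
Unshelve. all: by end_near. Qed.

(** The moduli of the points form a countable set, which is a null set, and so
    cannot contain an interval. *)
Lemma radius_off_seq (r0 : R) : r0 < 1 ->
  exists2 r, r0 < r < 1 & forall j, normc (a j) != r.
Proof.
move=> r01; apply: contrapT => H.
have sub : `]r0, 1[%classic `<=` (fun j => normc (a j)) @` setT.
  move=> r /=; rewrite in_itv /= => r_; apply: contrapT => nr; apply: H.
  by exists r => // j; apply/eqP => arj; apply: nr; exists j.
have c0 : countable `]r0, 1[%classic.
  apply: sub_countable (countableP [set: nat]).
  by apply: card_le_trans (subset_card_le sub) _; exact: card_image_le.
have := countable_lebesgue_measure0 c0.
rewrite lebesgue_measure_itv /= lte_fin r01 -EFinD => -[].
by move=> /eqP; rewrite gt_eqF// subr_gt0.
Qed.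

End blaschke_product.

(** * Circle means of Green functions *)

Section green_circle_means.
Context {R : realType}.
Implicit Types (z w a : cplx R) (r : R).
Notation mu := (@lebesgue_measure R).

Lemma measurable_lne_continuous (f : R -> R) (D : set R) : continuous f ->
  measurable_fun D (fun t => lne (f t)%:E).
Proof.
move=> cf; apply: measurable_funTS; rewrite /lne.
have mf : measurable_fun [set: R] f by exact: continuous_measurable_fun.
apply: measurable_fun_ifT.
- by apply: measurable_fun_ler => //; exact: measurable_cst.
- exact: measurable_cst.
- by apply/measurable_EFinP; apply: measurableT_comp.
Qed.

Lemma lt_green (c : R) a z : (c%:E < green a z)%E = (blaschke_modulus a z < expR (- c)).
Proof.
rewrite /green lteNr; have := blaschke_modulus_ge0 a z.
rewrite le_eqVlt => /predU1P[<-|b0].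
  by rewrite le0_lneNy// ltNyr expR_gt0.
by rewrite lne_EFin// lte_fin -[X in _ = (X < _)]lnK// ltr_expR.
Qed.

Lemma lee_of_lt_EFin (x y : \bar R) : (forall c : R, c%:E < x -> c%:E <= y)%E -> (x <= y)%E.
Proof.
move=> h; rewrite leNgt; apply/negP => yx; move: y x yx h => [s| |] [t| |]//.
- rewrite lte_fin => st /(_ ((s + t) / 2)); rewrite lte_fin lee_fin.
  by move=> /(_ ltac:(lra)); lra.
- by move=> _ /(_ (s + 1)); rewrite ltry lee_fin => /(_ isT); lra.
- by move=> _ /(_ (t - 1)); rewrite lte_fin ltrBlDr ltrDl ltr01 leeNy_eq => /(_ isT).
- by move=> _ /(_ 0); rewrite ltry leeNy_eq => /(_ isT).
Qed.

Lemma continuous_blaschke_circle a z r : normc a < 1 -> 0 <= r -> normc z + r < 1 ->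
  continuous (fun t => blaschke_modulus a (circle_point z r t)).
Proof.
move=> a1 r0 zr t; apply: continuous_comp; first exact: continuous_circle_point.
apply: continuous_blaschke_modulus => //; apply: le_lt_trans zr.
exact: le_normc_circle_point.
Qed.

Lemma measurable_green_circle a r (D : set R) : normc a < 1 -> 0 <= r -> r < 1 ->
  measurable_fun D (fun t => green a (circle_point 0%R r t)).
Proof.
move=> a1 r0 r1; apply: measurableT_comp => //; apply: measurable_lne_continuous.
by apply: continuous_blaschke_circle => //; rewrite normc0 add0r.
Qed.

Lemma green_circle_integral a r : normc a < 1 -> 0 < r < 1 -> normc a != r ->
  (\int[mu]_(t in `[0%R, (2 * pi)%R]) green a (circle_point 0%R r t) =
   (2 * pi * - ln (Num.max (normc a) r))%:E)%E.
Proof.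
move=> a1 r01 ar; have /andP[r0 r1] := r01.
have ne t : circle_point 0%R r t != a.
  by apply: contra ar => /eqP <-; rewrite normc_circle_point0// ltW.
have cr t : normc (circle_point 0%R r t) < 1 by rewrite normc_circle_point0// ltW.
have cln : continuous (fun t => ln (blaschke_modulus a (circle_point 0%R r t))).
  move=> t; apply: (@continuous_comp _ _ _ _ (fun w => ln (blaschke_modulus a w))).
    exact: continuous_circle_point.
  exact: continuous_ln_blaschke.
transitivity (\int[mu]_(t in `[0%R, (2 * pi)%R])
    (-1 * ln (blaschke_modulus a (circle_point 0%R r t)))%:E)%E.
  by apply: eq_integral => t _; rewrite green_fin// mulN1r.
rewrite mulrN -(ln_blaschke_circle_mean a1 r01 ar) /circle_integral.
rewrite -[in RHS]mulN1r -RintegralZl//; last exact: continuous_integrable.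
rewrite -[LHS]fineK//; apply: integrable_fin_num => //.
apply: (continuous_integrable _ _
  (f := fun t => -1 * ln (blaschke_modulus a (circle_point 0%R r t)))).
by move=> t; apply: cvgM; [exact: cvg_cst|exact: cln].
Qed.

(** For |a| = r the integrand is unbounded. Fatou's lemma is then applied along
    smaller circles, all of which have the mean -ln|a|. *)
Lemma green_circle_integral_le a r : normc a < 1 -> 0 < r < 1 ->
  (\int[mu]_(t in `[0%R, (2 * pi)%R]) green a (circle_point 0%R r t) <=
   (2 * pi * - ln (Num.max (normc a) r))%:E)%E.
Proof.
move=> a1 r01; have /andP[r0 r1] := r01.
have [ar|ar] := eqVneq (normc a) r; last by rewrite green_circle_integral.
pose rn (n : nat) : R := r * (1 - n.+2%:R^-1).
have rn0 n : 0 < rn n < r.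
  have h : 0 < n.+2%:R^-1 :> R by rewrite invr_gt0.
  have h2 : n.+2%:R^-1 < 1 :> R by rewrite invf_lt1// ltr1n.
  by rewrite mulr_gt0 ?subr_gt0//= gtr_pMr// ltrBlDr ltrDl.
have rn01 n : 0 < rn n < 1.
  by have /andP[h1 h2] := rn0 n; rewrite h1 (lt_trans h2).
have cvg_rn : rn n @[n --> \oo] --> r.
  rewrite -[X in _ --> X]mulr1; apply: cvgM; first exact: cvg_cst.
  rewrite -[X in _ --> X]subr0; apply: cvgB; first exact: cvg_cst.
  have : (@harmonic R) (n + 1)%N @[n --> \oo] --> (0 : R).
    by rewrite (@cvg_shiftn 1 _ (@harmonic R)); exact: cvg_harmonic.
  by apply: cvg_trans; apply: near_eq_cvg; near=> n; rewrite /harmonic addn1.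
pose f n t := green a (circle_point 0%R (rn n) t).
apply: (@le_trans _ _ (\int[mu]_(t in `[0%R, (2 * pi)%R]) limn_einf (f^~ t))%E).
  apply: ge0_le_integral => //.
  - by move=> t _; apply: green_ge0 => //; rewrite normc_circle_point0// ltW.
  - by apply: measurable_green_circle => //; exact: ltW.
  - rewrite /limn_einf; apply: measurableT_comp => //.
    apply: measurable_fun_limn_esup => n; apply: measurableT_comp => //.
    by have /andP[h1 h2] := rn01 n; apply: measurable_green_circle => //; exact: ltW.
  - move=> t _; apply: lee_of_lt_EFin => c; rewrite lt_green => bc.
    apply: limf_einf_ge.
    have cb : {for r, continuous (fun r => blaschke_modulus a (circle_point 0%R r t))}.
      apply: (@continuous_comp _ _ _ (fun r => circle_point 0%R r t) (blaschke_modulus a)).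
        rewrite (_ : (fun r => _) = (fun r => (r * cos t) +i* (r * sin t))); last first.
          by apply/funext => x; rewrite /circle_point add0r.
        apply: cvg_complex; apply: cvgM; (exact: cvg_id || exact: cvg_cst).
      by apply: continuous_blaschke_modulus => //; rewrite normc_circle_point0// ltW.
    have cbn : blaschke_modulus a (circle_point 0%R (rn n) t) @[n --> \oo] -->
        blaschke_modulus a (circle_point 0%R r t).
      exact: (continuous_cvg _ cb cvg_rn).
    apply: filterS (cvgr_lt _ cbn _ bc) => n bn.
    by rewrite ltW// lt_green.
apply: le_trans (fatou mu (measurable_itv _) _ _) _.
- move=> n; have /andP[h1 h2] := rn01 n.
  by apply: measurable_green_circle => //; exact: ltW.
- move=> n t _; have /andP[h1 h2] := rn01 n; apply: green_ge0 => //.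
  by rewrite normc_circle_point0// ltW.
apply: limf_einf_le; apply: nearW => n.
have /andP[h1 h2] := rn0 n.
rewrite /f green_circle_integral//; last by rewrite ar gt_eqF.
by rewrite !max_l ?ar// ltW.
Unshelve. all: by end_near. Qed.

(** For m = max(|a|, r) >= 1/2 one has
    -ln m <= 1/m - 1 <= 2 (1 - m) <= 2 (1 - |a|). *)
Lemma green_circle_integral_le_gap a r : normc a < 1 -> 1 / 2 <= r < 1 ->
  (\int[mu]_(t in `[0%R, (2 * pi)%R]) green a (circle_point 0%R r t) <=
   (4 * pi)%:E * (1 - normc a)%:E)%E.
Proof.
move=> a1 /andP[r0 r1]; have rp : 0 < r by lra.
apply: le_trans (green_circle_integral_le a1 _) _; first by rewrite rp r1.
set m := Num.max _ _; have rm : r <= m by rewrite le_max lexx orbT.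
have am : normc a <= m by rewrite le_max lexx.
have m0 : 0 < m by apply: lt_le_trans rm.
have mi : m^-1 <= 2 by rewrite -[2]invrK lef_pV2 ?posrE//; lra.
have m1 : m < 1 by rewrite gt_max a1 r1.
rewrite -EFinM lee_fin (_ : 4 * pi = 2 * pi * 2); last by ring.
rewrite -[leRHS]mulrA; apply: ler_wpM2l; first by rewrite ltW// twopi_gt0.
have := @ln_le_subr1 R m^-1; rewrite invr_gt0 m0 lnV// => /(_ isT).
have : m^-1 - 1 = m^-1 * (1 - m) by field; rewrite gt_eqF.
nra.
Qed.

Lemma green_circle_integral_le_ln a r : normc a < 1 -> 0 < r < 1 ->
  (\int[mu]_(t in `[0%R, (2 * pi)%R]) green a (circle_point 0%R r t) <=
   (2 * pi * - ln r)%:E)%E.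
Proof.
move=> a1 r01; apply: le_trans (green_circle_integral_le a1 r01) _.
have /andP[r0 _] := r01.
rewrite lee_fin; apply: ler_wpM2l; first by rewrite ltW// twopi_gt0.
by rewrite lerN2 ler_ln ?posrE ?lt_max ?r0 ?orbT// le_max lexx orbT.
Qed.

End green_circle_means.

(** * A lower bound for the maximal pseudometric *)

Section maximal_implies_zero_mean.
Context {R : realType} (I : set nat) (a : nat -> cplx R).
Hypothesis hC : finite_or_Blaschke I a.
Implicit Types (z w : cplx R) (r : R).
Notation mu := (@lebesgue_measure R).
Notation B := (blaschke_product I a).
Notation S := (blaschke_green I a).

Lemma oppe_lne_blaschke_product z : unit_disk z -> (- lne (B z)%:E)%E = S z.
Proof.
move=> zD; have := blaschke_green_ge0 hC zD; rewrite /blaschke_product.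
case: (S z) => [s| |]//= _; last by rewrite lexx.
by rewrite leNgt expR_gt0 /= expRK opprK.
Qed.

(** The first N terms are at most -2 pi ln r each, which tends to 0 as r tends
    to 1, while the others are controlled by the tail of the Blaschke sum,
    uniformly in r. *)
Lemma blaschke_green_circle_integral_small (e : R) : 0 < e ->
  \forall r \near (1 : R)^'-,
  (\int[mu]_(t in `[0%R, (2 * pi)%R]) S (circle_point 0%R r t) <= e%:E)%E.
Proof.
move=> e0; have p0 := @twopi_gt0 R.
have ep0 : 0 < e / (8 * pi) by rewrite divr_gt0// mulr_gt0// pi_gt0.
have [N tailN] := blaschke_tail hC ep0.
have lnr : \forall r \near (1 : R)^'-, (2 * pi * - ln r) * N%:R < e / 2.
  have : (2 * pi * - ln r) * N%:R @[r --> (1 : R)^'-] --> (2 * pi * - ln (1 : R)) * N%:R.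
    apply: cvg_at_left_filter; apply: cvgM; last exact: cvg_cst.
    apply: cvgM; first exact: cvg_cst.
    by apply: cvgN; exact: continuous_ln.
  by move=> /cvgr_lt; apply; rewrite ln1 oppr0 mulr0 mul0r divr_gt0.
near=> r.
have r12 : 1 / 2 <= r.
  rewrite ltW//; near: r; apply: nbhs_left_gt; lra.
have r1 : r < 1 by near: r; exact: nbhs_left_lt.
have r0 : 0 < r by lra.
have cD t : normc (circle_point 0%R r t) < 1 by rewrite normc_circle_point0// ltW.
pose f j t := if j \in I then green (a j) (circle_point 0%R r t) else 0%E.
have f0 j t : (0 <= f j t)%E.
  by rewrite /f; case: ifPn => // jI; apply: green_ge0 => //; exact: (seq_in_disk hC).
have fN j : j \notin I -> f j = cst 0%E.
  by move=> jI; apply/funext => t; rewrite /f (negbTE jI).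
have fI j : j \in I -> f j = fun t => green (a j) (circle_point 0%R r t).
  by move=> jI; apply/funext => t; rewrite /f jI.
rewrite (_ : (\int[mu]_(t in _) _)%E =
    (\int[mu]_(t in `[0%R, (2 * pi)%R]) (\sum_(0 <= j <oo) f j t))%E); last first.
  by apply: eq_integral => t _; rewrite /blaschke_green eseries_mkcond.
rewrite (@integral_nneseries _ _ R mu _ (measurable_itv _) f)//; last first.
  move=> j; have [jI|jI] := boolP (j \in I); last by rewrite fN.
  by rewrite fI//; apply: measurable_green_circle; [exact: (seq_in_disk hC)|exact: ltW|].
rewrite (nneseries_split_cond 0%N N); last by move=> j _; exact: integral_ge0.
rewrite add0n (splitr e) EFinD; apply: leeD.
  apply: (@le_trans _ _ (\sum_(0 <= j < N) (2 * pi * - ln r)%:E)%E).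
    apply: lee_sum => j _; have [jI|jI] := boolP (j \in I); last first.
      rewrite fN// integral0 lee_fin mulr_ge0 ?(ltW p0)// oppr_ge0 ln_le0// ltW.
    rewrite fI//; apply: green_circle_integral_le_ln; first exact: (seq_in_disk hC).
    by rewrite r0.
  rewrite sumEFin sumr_const_nat subn0 lee_fin -[X in X <= _]mulr_natr ltW//.
  by near: r.
apply: (@le_trans _ _ ((4 * pi)%:E * (e / (8 * pi))%:E)%E); last first.
  have pi0 : pi != 0 :> R by rewrite gt_eqF// pi_gt0.
  have E (q : R) : q != 0 -> 4 * q * (e / (8 * q)) = e / 2 by move=> q0; field.
  by rewrite -EFinM lee_fin E.
apply: (@le_trans _ _ (\sum_(N <= j <oo | j \in I) ((4 * pi)%:E * (1 - normc (a j))%:E))%E).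
  rewrite [leRHS]eseries_mkcond; apply: lee_nneseries => [j _ _|j _].
    exact: integral_ge0.
  case: ifPn => jI; last by rewrite fN// integral0.
  rewrite fI//; apply: green_circle_integral_le_gap; first exact: (seq_in_disk hC).
  by rewrite r12.
rewrite nneseriesZl; last first.
  by move=> j jI; rewrite lee_fin subr_ge0 ltW// (seq_in_disk hC).
by rewrite lee_wpmul2l ?lee_fin ?mulr_ge0 ?pi_ge0// ltW.
Unshelve. all: by end_near. Qed.

Definition blaschke_metric z : R := B z * hyperbolic_density z.

Lemma hyperbolic_density_gt0 z : unit_disk z -> 0 < hyperbolic_density z.
Proof. by move=> zD; rewrite -hyp1 hyp_gt0. Qed.

Lemma continuous_hyperbolic_density z : unit_disk z ->
  {for z, continuous hyperbolic_density}.
Proof.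
move=> zD; rewrite (_ : hyperbolic_density = hyp 1); first exact: continuous_hyp.
by apply/funext => w; rewrite hyp1.
Qed.

(** The logarithm of the Blaschke product has mean values off its zeros, so there
    the lower Laplacian of the logarithm of this metric is that of ln l_D, at
    least 4 l_D^2. At a point w of multiplicity n, the product is bounded by the
    n-th power of one Blaschke factor. *)
Lemma blaschke_metric_Phi : Phi I a blaschke_metric.
Proof.
have cm z : unit_disk z -> {for z, continuous blaschke_metric}.
  move=> zD; apply: (@cvgM _ _ (nbhs z) (nbhs_filter z)).
    exact: continuous_blaschke_product.
  exact: continuous_hyperbolic_density.
split; first split; first split.
- rewrite continuous_open_subspace; last exact: open_disk.
  by move=> z; rewrite inE; exact: cm.
- by move=> z zD; rewrite mulr_ge0 ?blaschke_product_ge0// ltW// hyperbolic_density_gt0.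
- have [r /andP[r0 r1] ar] := @radius_off_seq R a 0 ltr01.
  have rD : unit_disk (r%:C : cplx R).
    by rewrite /unit_disk /= expr0n addr0 sqrtr_sqr gtr0_norm.
  exists (r%:C) => //; rewrite mulf_neq0// gt_eqF// ?hyperbolic_density_gt0//.
  apply: blaschke_product_gt0 => // -[j jI aj].
  by have := ar j; rewrite aj normc_real gtr0_norm// eqxx.
- move=> z zD m0; have h0 := hyperbolic_density_gt0 zD.
  have B0 : 0 < B z by move: m0; rewrite /blaschke_metric pmulr_lgt0.
  have nz := blaschke_product_neq0 hC B0.
  have L : (lower_laplacian (fun w => ln (blaschke_metric w)) z =
      lower_laplacian (fun w => ln (hyp 1 w)) z)%E.
    apply: (@lower_laplacianD_mean_value R _ _ (fun w => ln (B w))).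
    + exact: near_continuous_ln_hyp.
    + exact: near_continuous_ln_blaschke_product.
    + apply: filterS (near_off_seq hC zD nz) => w [wD nw].
      rewrite -lnM ?posrE ?hyp_gt0 ?blaschke_product_gt0//.
      by rewrite /blaschke_metric hyp1 mulrC.
    + exact: ln_blaschke_product_mean_value.
  rewrite /curvature L.
  have := lower_laplacian_hyp_ge zD; rewrite hyp1 => Lge.
  have m2 : blaschke_metric z ^+ 2 <= hyperbolic_density z ^+ 2.
    rewrite ler_pXn2r ?nnegrE ?(ltW m0) ?(ltW h0)//.
    by rewrite ler_piMl ?(ltW h0)// blaschke_product_le1.
  have mm0 : 0 < blaschke_metric z ^+ 2 by rewrite exprn_gt0.
  move: Lge; case: (lower_laplacian _ z) => [l| |]//.
    rewrite !lee_fin => Lge; rewrite ler_pdivrMr// mulNr lerN2.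
    by apply: le_trans Lge; rewrite ler_pM2l.
  by move=> _; rewrite /= mulNyr gtr0_sg ?invr_gt0// mul1e leNye.
- move=> w [j jI ajw]; have wD : unit_disk w.
    by rewrite -ajw; apply: (seq_in_disk hC); exact: mem_set.
  pose m := multiplicity I a w.
  pose F z := hyperbolic_density z / normc (1 - (w^*)%C * z) ^+ m.
  have cF : {for w, continuous F}.
    pose FF := @nbhs_filter _ w.
    apply: (@cvgM _ _ (nbhs w) FF); first exact: continuous_hyperbolic_density.
    apply: (@cvgV _ _ (nbhs w) FF).
      by rewrite expf_neq0// gt_eqF// normc_1B_conjM_gt0.
    apply: (@continuous_comp _ _ _ (fun x : cplx R => normc (1 - (w^*)%C * x))
      (fun x : R => x ^+ m)); last first.
      exact: exprn_continuous.
    apply: (@continuous_comp _ _ _ (fun x : cplx R => (1 - (w^*)%C * x : cplx R))).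
      apply: (@cvgB _ _ _ (nbhs w) FF); first exact: (@cvg_cst _ _ _ (nbhs w) FF).
      apply: (@cvgM _ _ (nbhs w) FF); first exact: (@cvg_cst _ _ _ (nbhs w) FF).
      exact: cvg_id.
    exact: continuous_normc.
  have Fb : \forall z \near w, F z < F w + 1.
    by apply: (@cvgr_lt _ _ (nbhs w) (nbhs_filter w) _ _ cF); rewrite ltrDl.
  apply: (@le_lt_trans _ _ (F w + 1)%:E); last exact: ltry.
  apply: limf_esup_le.
  have : \forall z \near w, z != w ->
      ((blaschke_metric z / normc (z - w) ^+ m)%:E <= (F w + 1)%:E)%E.
    apply: filterS (filterI Fb (near_disk wD)) => z [Fz zD] zw.
    rewrite lee_fin; apply: le_trans (ltW Fz).
    rewrite ler_pdivrMr ?exprn_gt0 ?normc_gt0 ?subr_eq0// /blaschke_metric /F.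
    rewrite mulrAC -mulrA -expr_div_n mulrC.
    apply: ler_wpM2l; first by rewrite ltW// hyperbolic_density_gt0.
    exact: blaschke_product_le_multiplicity.
  exact.
Qed.

End maximal_implies_zero_mean.

Section zero_mean.
Context {R : realType} (I : set nat) (a : nat -> cplx R).
Hypothesis hC : finite_or_Blaschke I a.
Implicit Types (z w : cplx R) (r : R) (l : cplx R -> R).
Notation mu := (@lebesgue_measure R).
Notation B := (blaschke_product I a).
Notation S := (blaschke_green I a).

Lemma circle_in_disk r t : 0 <= r -> r < 1 -> unit_disk (circle_point 0 r t).
Proof. by move=> r0 r1; rewrite /unit_disk /mkset normc_circle_point0. Qed.

Lemma continuous_ratio_circle l r : {within unit_disk, continuous l} ->
  0 <= r -> r < 1 ->
  continuous (fun t => l (circle_point 0 r t) / hyperbolic_density (circle_point 0 r t)).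
Proof.
move=> cl r0 r1 t; have cD := circle_in_disk t r0 r1.
apply: (@continuous_comp _ _ _ (circle_point 0 r) (fun z => l z / hyperbolic_density z)).
  exact: continuous_circle_point.
set z := circle_point 0 r t in cD *.
apply: (@cvgM _ _ (nbhs z) (nbhs_filter z)); first exact: disk_continuous.
apply: (@cvgV _ _ (nbhs z) (nbhs_filter z)).
  by rewrite gt_eqF// hyperbolic_density_gt0.
exact: continuous_hyperbolic_density.
Qed.

(** Here 0 <= -ln(l/l_D) <= S, with S the sum of the Green functions, whose circle
    means tend to 0. The logarithm may be -oo on a circle through points of the
    sequence. *)
Lemma squeezed_zero_mean l : {within unit_disk, continuous l} ->
  (forall z, unit_disk z -> blaschke_metric I a z <= l z <= hyperbolic_density z) ->
  (\int[mu]_(t in `[0%R, (2 * pi)%R])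
      lne (l (circle_point 0 r t) / hyperbolic_density (circle_point 0 r t))%:E)%E
    @[r --> 1^'-] --> 0%E.
Proof.
move=> cl lle.
pose f r t : \bar R :=
  lne (l (circle_point 0 r t) / hyperbolic_density (circle_point 0 r t))%:E.
have bound : forall e, 0 < e -> \forall r \near (1 : R)^'-,
    (- e%:E <= \int[mu]_(t in `[0%R, (2 * pi)%R]) f r t <= 0)%E.
  move=> e e0; have Ssmall := blaschke_green_circle_integral_small hC e0.
  near=> r.
  have r0 : 0 < r by near: r; exact: nbhs_left_gt.
  have r1 : r < 1 by near: r; exact: nbhs_left_lt.
  have cD t := circle_in_disk t (ltW r0) r1.
  have f0 t : (0 <= - f r t)%E.
    rewrite oppe_ge0 lne_le0 lee_fin ler_pdivrMr ?hyperbolic_density_gt0// mul1r.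
    by case/andP: (lle _ (cD t)).
  have fS t : (- f r t <= S (circle_point 0%R r t))%E.
    rewrite -(oppe_lne_blaschke_product hC (cD t)) leeN2.
    apply: (le_trans (y := lne (B (circle_point 0%R r t))%:E)) => //.
    have /andP[Bl lh] := lle _ (cD t).
    have h0 := hyperbolic_density_gt0 (cD t).
    have l0 : 0 <= l (circle_point 0 r t).
      by apply: le_trans Bl; rewrite mulr_ge0 ?blaschke_product_ge0// ltW.
    rewrite lee_lne ?in_itv/= ?lee_fin ?leey ?blaschke_product_ge0 ?divr_ge0 ?(ltW h0)//.
    by rewrite ler_pdivlMr.
  have -> : (\int[mu]_(t in `[0%R, (2 * pi)%R]) f r t)%E =
      (- \int[mu]_(t in `[0%R, (2 * pi)%R]) - f r t)%E.
    by rewrite -integral_ge0N//; apply: eq_integral => t _; rewrite oppeK.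
  rewrite leeN2 oppe_le0 integral_ge0// andbT.
  have -> : (\int[mu]_(t in `[0%R, (2 * pi)%R]) - f r t <= e%:E)%E => //.
  apply: (@le_trans _ _ (\int[mu]_(t in `[0%R, (2 * pi)%R]) S (circle_point 0%R r t))%E).
    apply: ge0_le_integral => //.
    - apply: measurableT_comp => //; apply: measurable_lne_continuous.
      by apply: continuous_ratio_circle => //; exact: ltW.
    - rewrite (_ : (fun t => _) =
          fun t => (- lne (B (circle_point 0%R r t))%:E)%E); last first.
        by apply/funext => t; rewrite oppe_lne_blaschke_product.
      apply: measurableT_comp => //; apply: measurable_lne_continuous => t.
      apply: (@continuous_comp _ _ _ (circle_point 0 r) B).
        exact: continuous_circle_point.
      by apply: continuous_blaschke_product => //; exact: cD.
  by near: r.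
have fin : \forall r \near (1 : R)^'-,
    (\int[mu]_(t in `[0%R, (2 * pi)%R]) f r t)%E \is a fin_num.
  apply: filterS (bound 1 ltr01) => r /andP[h1 h2].
  by rewrite fin_numElt (lt_le_trans _ h1) ?ltNyr//= (le_lt_trans h2)// ltry.
apply/fine_cvgP; split => //.
apply/cvgrPdist_le => e e0; apply: filterS (filterI fin (bound e e0)) => r [h].
rewrite -(fineK h) -EFinN !lee_fin sub0r normrN /= => /andP[h1 h2].
by rewrite ler_norml h1 (le_trans h2)// ltW.
Unshelve. all: by end_near. Qed.

End zero_mean.

(** * The Poisson kernel *)

Section poisson_kernel.
Context {R : realType}.
Implicit Types (z w : cplx R) (r t rho tau : R).
Notation mu := (@lebesgue_measure R).

Definition poisson rho z t : R :=
  disk_gap rho z / normc (circle_point 0 rho t - z) ^+ 2.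

Lemma normc_circle_sub_ge rho z t : 0 <= rho ->
  rho - normc z <= normc (circle_point 0 rho t - z).
Proof.
move=> rho0; have := ler_normcB (circle_point 0 rho t) z.
by rewrite normc_circle_point0.
Qed.

Lemma normc_circle_sub_gt0 rho z t : normc z < rho ->
  0 < normc (circle_point 0 rho t - z).
Proof.
move=> zr; apply: (@lt_le_trans _ _ (rho - normc z)); first by rewrite subr_gt0.
by apply: normc_circle_sub_ge; apply: le_trans (ltW zr); exact: normc_ge0.
Qed.

Lemma poisson_ge0 rho z t : normc z < rho -> 0 <= poisson rho z t.
Proof.
move=> zr; have rho0 : 0 <= rho by apply: le_trans (ltW zr); exact: normc_ge0.
by rewrite divr_ge0 ?sqr_ge0// ltW// disk_gap_gt0.
Qed.

(** The form k/(m + n e^(is)) of the fraction on small circles about z gives the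
    mean value property in z. *)
Lemma poissonE rho z t : normc z < rho ->
  poisson rho z t =
  2 * Re (circle_point 0 rho t / (circle_point 0 rho t - z)) - 1.
Proof.
move=> zr; have rho0 : 0 <= rho by apply: le_trans (ltW zr); exact: normc_ge0.
have := normc_circle_sub_gt0 t zr; rewrite /poisson /disk_gap.
rewrite -{2}(normc_circle_point0 t rho0).
set zeta := circle_point 0 rho t => zz0.
have : normc (zeta - z) ^+ 2 != 0 by rewrite expf_neq0// gt_eqF.
rewrite !sqr_normc_ReIm; case: (zeta) z {zr zz0} => c d [x y] /= nz.
by field.
Qed.

Lemma poisson_le rho z t : normc z < rho ->
  poisson rho z t <= (rho + normc z) / (rho - normc z).
Proof.
move=> zr; have rho0 : 0 <= rho by apply: le_trans (ltW zr); exact: normc_ge0.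
have h := normc_circle_sub_ge z t rho0.
have d0 : 0 < rho - normc z by rewrite subr_gt0.
have -> : (rho + normc z) / (rho - normc z) = disk_gap rho z / (rho - normc z) ^+ 2.
  by rewrite /disk_gap; field; rewrite gt_eqF.
apply: ler_wpM2l; first by rewrite ltW// disk_gap_gt0.
rewrite lef_pV2 ?posrE ?exprn_gt0 ?(lt_le_trans d0)//.
by rewrite ler_pXn2r// nnegrE ?normc_ge0// ltW.
Qed.

Lemma continuous_poisson rho z : normc z < rho -> continuous (poisson rho z).
Proof.
move=> zr t; apply: cvgM; first exact: cvg_cst.
apply: cvgV; first by rewrite expf_neq0// gt_eqF// normc_circle_sub_gt0.
apply: (@continuous_comp _ _ _ (fun t => normc (circle_point 0 rho t - z))
  (fun x : R => x ^+ 2)); last exact: exprn_continuous.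
apply: (@continuous_comp _ _ _ (circle_point 0 rho) (fun w => normc (w - z))).
  exact: continuous_circle_point.
exact: continuous_normc_dist.
Qed.

Lemma continuous_Re_div_affine (k m n : cplx R) : normc n < normc m ->
  continuous (fun s => Re (k / (m + n * expi s))).
Proof.
move=> nm s; have m0 : m != 0.
  by rewrite -normc_gt0; apply: le_lt_trans nm; exact: normc_ge0.
have -> : (fun s => Re (k / (m + n * expi s))) =
    (fun x : cplx R => Re ((k / m) / (1 - x))) \o (fun s => - n / m * expi s).
  by apply/funext => x /=; rewrite -mulrA -invfM; congr (Re (_ / _)); field.
apply: continuous_comp; first exact: continuous_mul_expi.
apply: continuous_Re_div; apply: contraTN nm => /eqP h.
have := congr1 (@normc R) h.
rewrite normcM normc_expi mulr1 normcM normcN normcV normc1 => nm1.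
have nm0 : normc m != 0 by rewrite normc_eq0.
by rewrite -(divfK nm0 (normc n)) nm1 mul1r ltxx.
Qed.

Lemma poisson_integral rho z : normc z < rho ->
  \int[mu]_(t in `[0, 2 * pi]) poisson rho z t = 2 * pi.
Proof.
move=> zr; have rho0 : 0 < rho by apply: le_lt_trans zr; exact: normc_ge0.
pose q : cplx R := (z^*)%C / rho%:C.
have q1 : normc (- q) < normc (1 : cplx R).
  rewrite normcN normcM normcV normc_conj normc_real gtr0_norm// normc1.
  by rewrite ltr_pdivrMr// mul1r.
have E t : poisson rho z t = 2 * Re (1 / (1 + - q * expi t)) - 1.
  rewrite poissonE//; congr (2 * _ - 1).
  have -> : circle_point 0 rho t / (circle_point 0 rho t - z) =
      ((1 / (1 + - q * expi t))^*)%C.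
    rewrite !div1r fmorphV rmorphD rmorph1 rmorphM rmorphN /q fmorph_div.
    rewrite [X in X / _](conjcK z) [X in _ / X](conjc_real rho) circle_point_expi add0r.
    have e0 : expi t != 0 :> cplx R by rewrite -normc_gt0 normc_expi.
    have r0 : (rho%:C : cplx R) != 0 by rewrite -normc_gt0 normc_real gtr0_norm.
    have -> : rho%:C * expi t - z =
        (1 + - (z / rho%:C) * ((expi t)^*)%C) * (rho%:C * expi t).
      rewrite mulrDl mul1r !mulNr; congr (_ - _).
      by rewrite mulrACA divfK// [((expi t)^*)%C * _]mulrC expi_conj mulr1.
    by rewrite invfM mulrCA divff ?mulr1// mulf_neq0.
  by case: (1 / _).
under eq_Rintegral do rewrite E.
have cRe := continuous_Re_div_affine (k := 1) q1.
rewrite (@RintegralB _ _ _ mu _ _ (fun=> 1))//; last 2 first.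
- by apply: continuous_integrable => s; apply: cvgM; [exact: cvg_cst|exact: cRe].
- by apply: continuous_integrable => s; exact: cvg_cst.
rewrite RintegralZl//; last exact: continuous_integrable.
rewrite mean_Re_div_affine// Rintegral_2pi_cst divr1 /=; ring.
Qed.

Lemma poisson_mean_value rho z t tau : 0 < tau -> normc z + tau < rho ->
  circle_integral (fun w => poisson rho w t) z tau = 2 * pi * poisson rho z t.
Proof.
move=> tau0 zt; have zr : normc z < rho by apply: le_lt_trans zt; rewrite lerDl ltW.
have rho0 : 0 <= rho by apply: le_trans (ltW zr); exact: normc_ge0.
rewrite [in RHS]poissonE//; set zeta := circle_point 0 rho t.
have cr s : normc (circle_point z tau s) < rho.
  by apply: le_lt_trans zt; apply: le_normc_circle_point; exact: ltW.
have q1 : normc (- tau%:C : cplx R) < normc (zeta - z).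
  rewrite normcN normc_real gtr0_norm//.
  by apply: lt_le_trans (normc_circle_sub_ge z t rho0); rewrite ltrBrDl.
have cRe : continuous (fun s => Re (zeta / (zeta - z + - tau%:C * expi s))).
  exact: continuous_Re_div_affine.
transitivity (\int[mu]_(s in `[0, 2 * pi])
    (2 * Re (zeta / (zeta - z + - tau%:C * expi s)) - 1)).
  apply: eq_Rintegral => s _; rewrite poissonE// -/zeta; congr (2 * Re (_ / _) - 1).
  by rewrite circle_point_expi opprD addrA mulNr.
rewrite (@RintegralB _ _ _ mu _ _ (fun=> 1))//; last 2 first.
- by apply: continuous_integrable => s; apply: cvgM; [exact: cvg_cst|exact: cRe].
- by apply: continuous_integrable => s; exact: cvg_cst.
rewrite RintegralZl//; last exact: continuous_integrable.
by rewrite mean_Re_div_affine// Rintegral_2pi_cst; ring.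
Qed.

End poisson_kernel.

(** * Harmonic majorants from boundary values *)

Section fubini_square.
Context {R : realType}.
Notation mu := (@lebesgue_measure R).
Implicit Types (k : R -> R -> R).

(** Tonelli's theorem for the function cut off outside D x D by indicators. *)
Lemma integral_square_exchange (D : set R) k : measurable D ->
  measurable_fun [set: R * R] (fun x => k x.1 x.2) -> (forall s t, 0 <= k s t) ->
  (\int[mu]_(s in D) \int[mu]_(t in D) (k s t)%:E =
   \int[mu]_(t in D) \int[mu]_(s in D) (k s t)%:E)%E.
Proof.
move=> mD mk k0.
pose f (x : R * R) : \bar R := (\1_D x.1 * \1_D x.2 * k x.1 x.2)%:E.
have mf : measurable_fun [set: R * R] f.
  apply/measurable_EFinP; apply: measurable_funM => //.
  by apply: measurable_funM; apply: measurableT_comp.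
have f0 x : (0 <= f x)%E by rewrite lee_fin mulr_ge0.
have inner (g : R -> R) (c : R) : (forall t, 0 <= g t) ->
    (\int[mu]_t (c * \1_D t * g t)%:E = \int[mu]_(t in D) (c * g t)%:E)%E.
  move=> g0; rewrite [RHS]integral_mkcond; apply: eq_integral => t _.
  rewrite /patch indicE; case: ifPn => _ /=; first by rewrite mulr1.
  by rewrite mulr0 mul0r.
have outer (G : R -> \bar R) (H : R -> \bar R) :
    (forall s, D s -> G s = H s) -> (forall s, ~ D s -> G s = 0%E) ->
    (\int[mu]_s G s = \int[mu]_(s in D) H s)%E.
  move=> GH G0; rewrite [RHS]integral_mkcond; apply: eq_integral => s _.
  rewrite /patch; case: ifPn; first by rewrite inE => /GH.
  by rewrite notin_setE => /G0.
have ind1 s : D s -> \1_D s = 1 :> R by move=> Ds; rewrite indicE mem_set.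
have ind0 s : ~ D s -> \1_D s = 0 :> R by move=> Ds; rewrite indicE memNset.
transitivity (\int[mu]_s \int[mu]_t f (s, t))%E.
  apply/esym; apply: outer => s Ds; rewrite /f /=.
    rewrite inner; last by move=> t; exact: k0.
    by apply: eq_integral => t _; rewrite ind1// mul1r.
  by rewrite ind0//; under eq_integral do rewrite !mul0r; rewrite integral0.
rewrite (@fubini_tonelli _ _ _ _ R mu mu f mf f0).
apply: outer => t Dt; rewrite /f /=.
  under eq_integral do rewrite (mulrC (\1_D _)).
  rewrite (inner (fun s => k s t)); last by move=> s; exact: k0.
  by apply: eq_integral => s _; rewrite ind1// mul1r.
by rewrite ind0//; under eq_integral do rewrite mulr0 mul0r; rewrite integral0.
Qed.

(** The inner integrals are finite because the sections are continuous. *)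
Lemma Rintegral_square_exchange (a b : R) k :
  measurable_fun [set: R * R] (fun x => k x.1 x.2) -> (forall s t, 0 <= k s t) ->
  (forall s, continuous (k s)) -> (forall t, continuous (k^~ t)) ->
  \int[mu]_(s in `[a, b]) \int[mu]_(t in `[a, b]) k s t =
  \int[mu]_(t in `[a, b]) \int[mu]_(s in `[a, b]) k s t.
Proof.
move=> mk k0 c1 c2; rewrite /Rintegral; congr fine.
have fin1 s : (\int[mu]_(t in `[a, b]) (k s t)%:E)%E \is a fin_num.
  by apply: integrable_fin_num => //; exact: (continuous_integrable _ _ (c1 s)).
have fin2 t : (\int[mu]_(s in `[a, b]) (k s t)%:E)%E \is a fin_num.
  by apply: integrable_fin_num => //; exact: (continuous_integrable _ _ (c2 t)).
under eq_integral do rewrite fineK//.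
under [RHS]eq_integral do rewrite fineK//.
exact: integral_square_exchange.
Qed.

End fubini_square.

Section uniform_continuity.
Context {R : realType}.
Implicit Types (z w : cplx R).

Lemma compact_uniformly_continuous (A : set (cplx R)) (G : cplx R -> R) :
  compact A -> (forall z, A z -> {for z, continuous G}) ->
  forall e, 0 < e -> exists2 d, 0 < d &
    forall z w, A z -> normc (w - z) < d -> `|G w - G z| < e.
Proof.
move=> /compact_near_coveringP cA cG e e0.
have := cA R (0 : R)^'+ (fun d z => forall w, normc (w - z) < d -> `|G w - G z| < e) _.
move=> /(_ _)[].
  move=> z Az; have e20 : 0 < e / 2 by rewrite divr_gt0.
  have := cG z Az => /(@cvgrPdist_lt _ _ _ _ (nbhs_filter z))/(_ _ e20).
  move=> /nbhs_normcP[d d0 Hd]; have d20 : 0 < d / 2 by rewrite divr_gt0.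
  exists ([set x | normc (x - z) < d / 2], [set x | x < d / 2]).
    split => /=; first by apply/nbhs_normcP; exists (d / 2).
    exact: nbhs_right_lt.
  move=> [x s] /= [xz sd] w wx.
  have h1 : normc (x - z) < d by lra.
  have h2 : normc (w - z) < d.
    apply: (@le_lt_trans _ _ (normc (w - x) + normc (x - z))); last lra.
    apply: le_trans (le_normcD _ _).
    by rewrite addrA subrK.
  have := Hd _ h1; have := Hd _ h2; rewrite !ltr_norml => /andP[a1 a2] /andP[b1 b2].
  by apply/andP; split; lra.
move=> d /= d0 Hd; exists (d / 2); first by rewrite divr_gt0.
move=> z w Az wz; apply: (Hd (d / 2)) => //; last by rewrite divr_gt0.
by rewrite /ball_ /= sub0r normrN gtr0_norm ?divr_gt0// ltr_pdivrMr// ltr_pMr// ltr1n.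
Qed.

End uniform_continuity.

Section poisson_extension.
Context {R : realType}.
Implicit Types (z w : cplx R) (r t rho tau : R) (F : R -> R) (G : cplx R -> R).
Notation mu := (@lebesgue_measure R).

(** The datum F sits on the circle of radius rho, but it will be sampled from a
    smaller circle; thus the extension is continuous on the closed disk bounded
    by the latter. *)
Definition poisson_extension rho F z : R :=
  (2 * pi)^-1 * \int[mu]_(t in `[0, 2 * pi]) (poisson rho z t * F t).

Lemma continuous_poisson_mul rho F z : continuous F -> normc z < rho ->
  continuous (fun t => poisson rho z t * F t).
Proof. by move=> cF zr t; apply: cvgM; [exact: continuous_poisson|exact: cF]. Qed.

Lemma poisson_extension_ge0 rho F z : (forall t, 0 <= F t) -> normc z < rho ->
  0 <= poisson_extension rho F z.
Proof.
move=> F0 zr; rewrite mulr_ge0 ?invr_ge0 ?(ltW (twopi_gt0))//.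
by apply: Rintegral_ge0 => t _; rewrite mulr_ge0// poisson_ge0.
Qed.

Lemma poisson_extension_le rho F z : continuous F -> (forall t, 0 <= F t) ->
  normc z < rho -> poisson_extension rho F z <=
  (rho + normc z) / (rho - normc z) * ((2 * pi)^-1 * \int[mu]_(t in `[0, 2 * pi]) F t).
Proof.
move=> cF F0 zr; rewrite [leRHS]mulrCA; apply: ler_wpM2l.
  by rewrite invr_ge0 ltW// twopi_gt0.
rewrite -RintegralZl//; last exact: continuous_integrable.
apply: le_Rintegral => //.
- by apply: continuous_integrable; exact: continuous_poisson_mul.
- by apply: continuous_integrable => t; apply: cvgM; [exact: cvg_cst|exact: cF].
- by move=> t _; apply: ler_wpM2r => //; exact: poisson_le.
Qed.

Lemma poisson_lipschitz rho r z w t : 0 <= r -> r < rho -> normc z <= r -> normc w <= r ->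
  `|poisson rho z t - poisson rho w t| <= 2 * rho / (rho - r) ^+ 2 * normc (z - w).
Proof.
move=> r0 rr zr wr; have zr' := le_lt_trans zr rr; have wr' := le_lt_trans wr rr.
have rho0 : 0 < rho by apply: le_lt_trans rr.
rewrite !poissonE//; set zeta := circle_point 0 rho t.
have hz : rho - r <= normc (zeta - z).
  by apply: le_trans (normc_circle_sub_ge z t (ltW rho0)); rewrite lerD2l lerN2.
have hw : rho - r <= normc (zeta - w).
  by apply: le_trans (normc_circle_sub_ge w t (ltW rho0)); rewrite lerD2l lerN2.
have d0 : 0 < rho - r by rewrite subr_gt0.
have z0 : zeta - z != 0 by rewrite -normc_gt0 (lt_le_trans d0).
have w0 : zeta - w != 0 by rewrite -normc_gt0 (lt_le_trans d0).
have E : zeta / (zeta - z) - zeta / (zeta - w) = zeta * (z - w) / ((zeta - z) * (zeta - w)).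
  by field; rewrite z0 w0.
have -> : 2 * Re (zeta / (zeta - z)) - 1 - (2 * Re (zeta / (zeta - w)) - 1) =
    2 * Re (zeta * (z - w) / ((zeta - z) * (zeta - w))).
  rewrite -E; case: (zeta / (zeta - z)) => x1 y1; case: (zeta / (zeta - w)) => x2 y2 /=.
  by ring.
rewrite normrM ger0_norm// -!mulrA; apply: ler_wpM2l => //.
apply: le_trans (Re_le_normc _) _.
rewrite !normcM normcV normcM normc_circle_point0 ?(ltW rho0)//.
apply: ler_wpM2l; first exact: ltW.
rewrite mulrC; apply: ler_wpM2r; first exact: normc_ge0.
rewrite lef_pV2 ?posrE ?mulr_gt0 ?exprn_gt0 ?(lt_le_trans d0)// expr2.
by apply: ler_pM => //; exact: ltW.
Qed.

(** The kernel is Lipschitz in z, uniformly in t, as long as z stays away from the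
    circle of radius rho. *)
Lemma continuous_poisson_extension rho F z : continuous F -> (forall t, 0 <= F t) ->
  normc z < rho -> {for z, continuous (poisson_extension rho F)}.
Proof.
move=> cF F0 zr; have z0 := normc_ge0 z.
pose r := (normc z + rho) / 2.
have zr1 : normc z < r by rewrite /r; lra.
have rr : r < rho by rewrite /r; lra.
have r0 : 0 <= r by lra.
pose K := 2 * rho / (rho - r) ^+ 2.
have K0 : 0 <= K by rewrite divr_ge0 ?sqr_ge0//; lra.
pose M := (2 * pi)^-1 * \int[mu]_(t in `[0, 2 * pi]) F t.
have M0 : 0 <= M.
  by rewrite mulr_ge0 ?invr_ge0 ?(ltW twopi_gt0)//; apply: Rintegral_ge0.
have lip w : normc w < r -> `|poisson_extension rho F z - poisson_extension rho F w| <=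
    K * M * normc (z - w).
  move=> wr; have wrho := lt_trans wr rr.
  rewrite /poisson_extension -mulrBr normrM ger0_norm ?invr_ge0 ?(ltW twopi_gt0)//.
  rewrite (_ : K * M * _ = (2 * pi)^-1 *
      (K * normc (z - w) * \int[mu]_(t in `[0, 2 * pi]) F t)); last by rewrite /M; ring.
  apply: ler_wpM2l; first by rewrite invr_ge0 (ltW twopi_gt0).
  have cz := continuous_poisson_mul cF zr.
  have cw := continuous_poisson_mul cF wrho.
  rewrite -RintegralB//; [|exact: continuous_integrable..].
  have cB : continuous (fun t => poisson rho z t * F t - poisson rho w t * F t).
    by move=> t; apply: cvgB; [exact: cz|exact: cw].
  apply: le_trans (le_normr_Rintegral _ (continuous_integrable _ _ cB)) _ => //.
  rewrite -RintegralZl//; last exact: continuous_integrable.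
  apply: le_Rintegral => //.
  - by apply: continuous_integrable => t; apply: cvg_norm; exact: cB.
  - by apply: continuous_integrable => t; apply: cvgM; [exact: cvg_cst|exact: cF].
  - move=> t _; rewrite -mulrBl normrM (ger0_norm (F0 t)); apply: ler_wpM2r => //.
    by apply: poisson_lipschitz => //; exact: ltW.
apply/(@cvgrPdist_lt _ _ _ _ (nbhs_filter z)) => e e0.
have KM0 : 0 < K * M + 1 by rewrite ltr_wpDl// mulr_ge0.
apply/nbhs_normcP; exists (Num.min (r - normc z) (e / (K * M + 1))).
  by rewrite lt_min subr_gt0 zr1 divr_gt0.
move=> w; rewrite lt_min => /andP[w1 w2].
have wr : normc w < r by have := ler_normcB w z; lra.
apply: le_lt_trans (lip _ wr) _.
rewrite normc_distC; rewrite ltr_pdivlMr// in w2.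
apply: le_lt_trans w2; rewrite mulrC; apply: ler_wpM2l; first exact: normc_ge0.
by rewrite lerDl.
Qed.

End poisson_extension.

Section poisson_properties.
Context {R : realType}.
Implicit Types (z w : cplx R) (r t rho tau : R) (F : R -> R) (G : cplx R -> R).
Notation mu := (@lebesgue_measure R).

Lemma continuous_poisson_point rho z t : normc z < rho ->
  {for z, continuous (fun w => poisson rho w t)}.
Proof.
move=> zr; have rho0 : 0 <= rho by apply: le_trans (ltW zr); exact: normc_ge0.
pose FF := @nbhs_filter _ z.
apply: (@cvgM _ _ (nbhs z) FF); first exact: continuous_disk_gap.
apply: (@cvgV _ _ (nbhs z) FF).
  by rewrite expf_neq0// gt_eqF// normc_circle_sub_gt0.
have E : (fun w : cplx R => normc (circle_point 0 rho t - w) ^+ 2) =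
    fun w => normc (w - circle_point 0 rho t) ^+ 2.
  by apply/funext => w; rewrite normc_distC.
rewrite E normc_distC.
by apply: (@cvgM _ _ (nbhs z) FF); exact: continuous_normc_dist.
Qed.

(** The kernel is an expression in sines and cosines; the reciprocal of the
    nonnegative denominator is a real power. *)
Lemma measurable_poisson_circle rho z tau F : continuous F ->
  measurable_fun [set: R * R]
    (fun x : R * R => poisson rho (circle_point z tau x.1) x.2 * F x.2).
Proof.
move=> cF.
have m1 (f : R -> R) : continuous f -> measurable_fun [set: R * R] (fun x => f x.1).
  by move=> cf; apply: measurableT_comp => //; exact: continuous_measurable_fun.
have m2 (f : R -> R) : continuous f -> measurable_fun [set: R * R] (fun x => f x.2).
  by move=> cf; apply: measurableT_comp => //; exact: continuous_measurable_fun.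
apply: measurable_funM; last exact: m2.
rewrite (_ : (fun x => _) = fun x : R * R =>
  disk_gap rho (circle_point z tau x.1) *
  ((rho * cos x.2 - (Re z + tau * cos x.1)) ^+ 2 +
   (rho * sin x.2 - (Im z + tau * sin x.1)) ^+ 2) `^ (-1)); last first.
  apply/funext => x; rewrite powR_inv1 ?addr_ge0 ?sqr_ge0//.
  rewrite /poisson sqr_normc_ReIm; congr (_ / (_ ^+ 2 + _ ^+ 2));
    by rewrite !circle_point_ReIm /= add0r.
have ccos (c d : R) : continuous (fun t => c + d * cos t).
  move=> t; apply: cvgD; first exact: cvg_cst.
  by apply: cvgM; [exact: cvg_cst|exact: continuous_cos].
have csin (c d : R) : continuous (fun t => c + d * sin t).
  move=> t; apply: cvgD; first exact: cvg_cst.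
  by apply: cvgM; [exact: cvg_cst|exact: continuous_sin].
apply: measurable_funM.
  apply: (m1 (fun s => disk_gap rho (circle_point z tau s))) => s.
  apply: continuous_comp; first exact: continuous_circle_point.
  exact: continuous_disk_gap.
apply: (@measurableT_comp _ _ _ _ _ _ (@powR R ^~ (-1))).
  exact: measurable_powR.
have c0 : continuous (fun t : R => rho * cos t).
  by move=> t; apply: cvgM; [exact: cvg_cst|exact: continuous_cos].
have s0 : continuous (fun t : R => rho * sin t).
  by move=> t; apply: cvgM; [exact: cvg_cst|exact: continuous_sin].
apply: measurable_funD; apply: measurable_funX; apply: measurable_funB.
- exact: (m2 (fun t => rho * cos t)).
- exact: (m1 _ (ccos _ _)).
- exact: (m2 (fun t => rho * sin t)).
- exact: (m1 _ (csin _ _)).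
Qed.

Lemma poisson_extension_circle_integral rho F z tau : continuous F ->
  (forall t, 0 <= F t) -> 0 < tau -> normc z + tau < rho ->
  circle_integral (poisson_extension rho F) z tau =
  2 * pi * poisson_extension rho F z.
Proof.
move=> cF F0 tau0 zt.
have zr : normc z < rho by apply: le_lt_trans zt; rewrite lerDl ltW.
have cr s : normc (circle_point z tau s) < rho.
  by apply: le_lt_trans zt; apply: le_normc_circle_point; exact: ltW.
pose k s t := poisson rho (circle_point z tau s) t * F t.
have k0 s t : 0 <= k s t by rewrite mulr_ge0// poisson_ge0.
have ck1 s : continuous (k s) by apply: continuous_poisson_mul.
have cp t : continuous (fun s => poisson rho (circle_point z tau s) t).
  move=> s; apply: (@continuous_comp _ _ _ (circle_point z tau) (fun w => poisson rho w t)).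
    exact: continuous_circle_point.
  exact: continuous_poisson_point.
have ck2 t : continuous (k^~ t).
  by move=> s; apply: cvgM; [exact: cp|exact: cvg_cst].
have E : \int[mu]_(s in `[0, 2 * pi]) \int[mu]_(t in `[0, 2 * pi]) k s t =
    2 * pi * \int[mu]_(t in `[0, 2 * pi]) (poisson rho z t * F t).
  rewrite Rintegral_square_exchange//; last first.
    exact: measurable_poisson_circle.
  rewrite -RintegralZl//; last first.
    by apply: continuous_integrable; exact: continuous_poisson_mul.
  apply: eq_Rintegral => t _; rewrite /k RintegralZr//; last first.
    by apply: continuous_integrable; exact: cp.
  rewrite -[X in X * _]/(circle_integral (fun w => poisson rho w t) z tau).
  by rewrite poisson_mean_value// mulrA.
have intk : mu.-integrable `[0, 2 * pi]
    (EFin \o (fun s => \int[mu]_(t in `[0, 2 * pi]) k s t)).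
  have cc : continuous (fun s => poisson_extension rho F (circle_point z tau s)).
    move=> s; apply: (@continuous_comp _ _ _ (circle_point z tau)).
      exact: continuous_circle_point.
    exact: continuous_poisson_extension.
  have H : (fun s => \int[mu]_(t in `[0, 2 * pi]) k s t) =
     (fun s => 2 * pi * poisson_extension rho F (circle_point z tau s)).
    apply/funext => x; rewrite /poisson_extension mulrA divff ?mul1r//.
    by rewrite gt_eqF// twopi_gt0.
  apply: continuous_integrable; rewrite H => s.
  by apply: cvgM; [exact: cvg_cst|exact: cc].
by rewrite /circle_integral /poisson_extension RintegralZl// E mulrCA.
Qed.

Lemma poisson_extension_mean_value rho F z : continuous F ->
  (forall t, 0 <= F t) -> normc z < rho ->
  mean_value_at (poisson_extension rho F) z.
Proof.
move=> cF F0 zr; apply: filterS (near_circle_in_disk zr) => tau [tau0 zt].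
exact: poisson_extension_circle_integral.
Qed.

(** The kernel has mean 1, and away from z it is bounded by kap rho, which tends
    to 0 as rho decreases to r. So the extension is at least nearly the value of
    G near z. *)
Lemma poisson_extension_boundary G r e : 0 < r -> 0 < e ->
  (forall z, 0 <= G z) -> (forall z, normc z = r -> {for z, continuous G}) ->
  \forall rho \near r^'+, forall z, normc z = r ->
    G z - e <= poisson_extension rho (fun t => G (circle_point 0 r t)) z.
Proof.
move=> r0 e0 G0 cG; pose C := [set z : cplx R | normc z = r].
have cC : compact C.
  apply: (@subclosed_compact _ _ [set z : cplx R | normc z <= r]).
  - apply: (@closed_comp _ _ (@normc R : cplx R -> R) [set x | x = r]).
      by move=> z _; exact: continuous_normc.
    exact: closed_eq.
  - exact: compact_closed_disk.
  - by move=> z /= ->.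
have e20 : 0 < e / 2 by rewrite divr_gt0.
have [d d0 Gd] := compact_uniformly_continuous cC cG e20.
have C0 : C !=set0.
  by exists (circle_point 0 r 0); rewrite /C /mkset normc_circle_point0// ltW.
have [c _ Gc] : exists2 c, c \in C & forall z, z \in C -> G z <= G c.
  apply: compact_EVT_max => //.
  by apply: continuous_in_subspaceT => z; rewrite inE; exact: cG.
pose kap rho := (rho ^+ 2 - r ^+ 2) / (d / 2) ^+ 2.
have kap0 : kap rho * G c @[rho --> r^'+] --> kap r * G c.
  apply: cvg_at_right_filter; apply: cvgM; last exact: cvg_cst.
  apply: cvgM; last exact: cvg_cst.
  by apply: cvgB; [exact: exprn_continuous|exact: cvg_cst].
have F0 t : 0 <= G (circle_point 0 r t) by exact: G0.
have cF : continuous (fun t => G (circle_point 0 r t)).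
  move=> t; apply: continuous_comp; first exact: continuous_circle_point.
  by apply: cG; rewrite normc_circle_point0// ltW.
have nearkap : \forall rho \near r^'+, kap rho * G c < e / 2.
  by apply: (cvgr_lt _ kap0); rewrite /kap subrr !mul0r.
near=> rho => z zr.
have rrho : r < rho by near: rho; exact: nbhs_right_gt.
have rhod : rho < r + d / 2 by near: rho; apply: nbhs_right_lt; rewrite ltrDl divr_gt0.
have kape : kap rho * G c < e / 2 by near: rho.
have zrho : normc z < rho by rewrite zr.
have rho0 : 0 < rho by apply: lt_trans rrho.
have Gzc : G z <= G c by apply: Gc; rewrite inE.
have pw t : poisson rho z t * (G z - e / 2) - kap rho * G c <=
    poisson rho z t * G (circle_point 0 r t).
  have P0 := poisson_ge0 t zrho.
  have kapG0 : 0 <= kap rho * G c.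
    rewrite mulr_ge0// divr_ge0 ?sqr_ge0// subr_ge0 ler_pXn2r// ?nnegrE ltW//.
  have [near_t|far_t] := ltP (normc (circle_point 0 r t - z)) d.
    have := Gd _ _ zr near_t; rewrite ltr_norml => /andP[h1 _].
    rewrite lerBlDr; apply: ler_wpDr => //; apply: ler_wpM2l => //; lra.
  have far : d / 2 <= normc (circle_point 0 rho t - z).
    have h1 : normc (circle_point 0 rho t - circle_point 0 r t) = rho - r.
      rewrite !circle_point_expi !add0r -mulrBl normcM normc_expi mulr1.
      rewrite (_ : rho%:C - r%:C = (rho - r)%:C); last by rewrite rmorphB.
      by rewrite normc_real gtr0_norm// subr_gt0.
    have h2 := le_normcD (circle_point 0 r t - circle_point 0 rho t)
      (circle_point 0 rho t - z).
    rewrite addrA subrK (normc_distC _ (circle_point 0 rho t)) h1 in h2.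
    lra.
  have Pk : poisson rho z t <= kap rho.
    rewrite /poisson /disk_gap /kap zr; apply: ler_wpM2l.
      by rewrite subr_ge0 ler_pXn2r// ?nnegrE ltW.
    rewrite lef_pV2 ?posrE ?exprn_gt0 ?divr_gt0// ?(lt_le_trans _ far) ?divr_gt0//.
    by rewrite ler_pXn2r// nnegrE ?normc_ge0// divr_ge0// ltW.
  apply: (@le_trans _ _ 0); last by rewrite mulr_ge0.
  rewrite subr_le0; apply: (@le_trans _ _ (poisson rho z t * G c)).
    by apply: ler_wpM2l => //; lra.
  by apply: ler_wpM2r.
have p0 := @twopi_gt0 R.
have cP := continuous_poisson zrho.
rewrite /poisson_extension -(ler_pM2l p0) mulrA divff ?gt_eqF// mul1r.
have cP' : continuous (fun t => poisson rho z t * (G z - e / 2)).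
  by move=> t; apply: cvgM; [exact: cP|exact: cvg_cst].
apply: (@le_trans _ _ (\int[mu]_(t in `[0, 2 * pi])
    (poisson rho z t * (G z - e / 2) - kap rho * G c))).
  rewrite (@RintegralB _ _ _ mu _ _ (fun=> kap rho * G c))//; last 2 first.
  - exact: continuous_integrable.
  - by apply: continuous_integrable => t; exact: cvg_cst.
  rewrite RintegralZr//; last exact: continuous_integrable.
  rewrite poisson_integral// Rintegral_2pi_cst -mulrBr ler_pM2l//; lra.
apply: le_Rintegral => //.
- apply: continuous_integrable => t; apply: cvgB; first exact: cP'.
  exact: cvg_cst.
- by apply: continuous_integrable; exact: continuous_poisson_mul.
Unshelve. all: by end_near. Qed.

End poisson_properties.

(** * Comparison with a pseudometric of vanishing mean *)

Section zero_mean_implies_maximal.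
Context {R : realType} (I : set nat) (a : nat -> cplx R).
Hypothesis hC : finite_or_Blaschke I a.
Implicit Types (z w : cplx R) (r rho e : R) (l m u v : cplx R -> R).
Notation mu := (@lebesgue_measure R).
Notation B := (blaschke_product I a).

Lemma powR_le1 (x e : R) : 0 <= x -> x <= 1 -> 0 <= e -> x `^ e <= 1.
Proof.
move=> x0 x1 e0; have -> : (1 : R) = 1 `^ e by rewrite powR1.
by apply: ge0_ler_powR; rewrite ?nnegrE.
Qed.

Lemma mean_value_atZ (c : R) u z : (\forall w \near z, {for w, continuous u}) ->
  mean_value_at u z -> mean_value_at (fun w => c * u w) z.
Proof.
move=> cu mu_u; have cu' := near_circle_continuous cu; near=> r.
have cur : continuous (fun t => u (circle_point z r t)) by near: r.
rewrite /circle_integral RintegralZl//; last exact: continuous_integrable.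
rewrite -/(circle_integral u z r) mulrCA; congr (_ * _).
by near: r.
Unshelve. all: by end_near. Qed.

Lemma near_punctured_off_seq w : unit_disk w ->
  \forall z \near w, z != w -> unit_disk z /\ ~ seq_points I a z.
Proof.
move=> wD; have [d d0 dP] := seq_locally_finite hC wD.
apply/nbhs_normcP; exists d => // z /dP[z1 za] zw; split=> // -[j jI ajz].
have := za j (mem_set jI); rewrite ajz => /(_ zw).
by rewrite subrr normc0 leNgt d0.
Qed.

Lemma conformal_ge0 l z : conformal_pseudometric unit_disk l -> unit_disk z -> 0 <= l z.
Proof. by case=> _ + _; apply. Qed.

(** Near w, the density m is at most, and l at least, a constant multiple of
    |z - w|^n, where n is the multiplicity of w. *)
Lemma zero_ratio_bounded l m w : conformal_pseudometric unit_disk l ->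
  has_zero_set unit_disk l I a -> Phi I a m -> seq_points I a w -> unit_disk w ->
  exists2 C, 0 < C & \forall z \near w, z != w -> m z / l z <= C.
Proof.
move=> cl [_ zl] [[[cm m0 _] _] phim] ws wD.
have [c c0 lc] := zl w ws.
set n := multiplicity I a w in lc.
have := phim w ws; rewrite -/n => msup.
have [M Mgt] : exists M : R,
    (limf_esup (fun z => (m z / normc (z - w) ^+ n)%:E) w^' < M%:E)%E.
  move: msup; case: limf_esup => [s| |]// _; last by exists 0; rewrite ltNyr.
  by exists (s + 1); rewrite lte_fin ltrDl.
have FF : Filter w^' by exact: within_filter.
have nearM : \forall z \near w, z != w ->
    ((m z / normc (z - w) ^+ n)%:E < M%:E)%E := limf_esup_lt FF Mgt.
have c20 : 0 < `|c| / 2 by rewrite divr_gt0// normr_gt0.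
have nearc : \forall z \near w, z != w ->
    `|c - l z / normc (z - w) ^+ n| < `|c| / 2.
  by move: lc => /(@cvgrPdist_lt _ _ _ _ FF)/(_ _ c20).
exists (Num.max M 1 / (`|c| / 2)).
  by rewrite divr_gt0// lt_max ltr01 orbT.
apply: filterS (filterI (filterI nearM nearc) (near_disk wD)) => z [[+ +] zD] zw.
move=> /(_ zw) + /(_ zw).
rewrite lte_fin => Mz cz.
have X0 : 0 < normc (z - w) ^+ n by rewrite exprn_gt0// normc_gt0 subr_eq0.
have l0 : 0 <= l z / normc (z - w) ^+ n by rewrite divr_ge0 ?(ltW X0)// conformal_ge0.
have cl2 : `|c| / 2 < l z / normc (z - w) ^+ n.
  have h := ler_normB (l z / normc (z - w) ^+ n) (l z / normc (z - w) ^+ n - c).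
  rewrite opprB addrC subrK (ger0_norm l0) distrC in h.
  lra.
have lz : l z != 0 by apply: contraTneq cl2 => ->; rewrite mul0r -leNgt ltW.
rewrite (_ : m z / l z =
    (m z / normc (z - w) ^+ n) / (l z / normc (z - w) ^+ n)); last first.
  by field; rewrite lz gt_eqF.
apply: ler_pM => //.
- by rewrite divr_ge0 ?(ltW X0)// m0.
- by rewrite invr_ge0.
- by rewrite le_max ltW.
- by rewrite lef_pV2 ?posrE ?(ltW cl2)// (lt_trans c20).
Qed.

Section comparison.
Variable l : cplx R -> R.
Hypothesis cl : conformal_pseudometric unit_disk l.
Hypothesis curvl : constant_curvature_m4 unit_disk l.
Hypothesis zerol : has_zero_set unit_disk l I a.

Let contl z : unit_disk z -> {for z, continuous l}.
Proof. by case: cl => c _ _; exact: disk_continuous. Qed.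

Let lpos z : unit_disk z -> ~ seq_points I a z -> 0 < l z.
Proof. by move=> zD nz; case: zerol => + _; apply. Qed.

Lemma constant_curvature_SK : SK_metric unit_disk l.
Proof. by split=> // z zD l0; case: curvl => _ ->. Qed.

(** Minus the logarithm of l/l_D, by Ahlfors' lemma; the absolute value makes it
    nonnegative outside the disk, too. *)
Let G z : R := `|ln (l z / hyperbolic_density z)|.

Let G_disk z : unit_disk z -> ~ seq_points I a z ->
  G z = ln (hyperbolic_density z) - ln (l z).
Proof.
move=> zD nz; have h0 := hyperbolic_density_gt0 zD; have l0 := lpos zD nz.
rewrite /G ln_div ?posrE// ler0_norm; first by rewrite opprB.
by rewrite subr_le0 ler_ln ?posrE//; exact: ahlfors constant_curvature_SK _ zD.
Qed.

Let contG z : unit_disk z -> ~ seq_points I a z -> {for z, continuous G}.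
Proof.
move=> zD nz; have h0 := hyperbolic_density_gt0 zD; have l0 := lpos zD nz.
apply: (@continuous_comp _ _ _ (fun z => ln (l z / hyperbolic_density z)) Num.norm).
  apply: (@continuous_comp _ _ _ (fun z => l z / hyperbolic_density z) (@ln R)).
    apply: (@cvgM _ _ (nbhs z) (nbhs_filter z)); first exact: contl.
    apply: (@cvgV _ _ (nbhs z) (nbhs_filter z)); first by rewrite gt_eqF.
    exact: continuous_hyperbolic_density.
  by apply: continuous_ln; rewrite divr_gt0.
exact: norm_continuous.
Qed.

(** The maximum principle for v = ln l + h - e ln B. Its lower Laplacian is the one
    of ln l, that is 4 l^2, since h and ln B have mean values. The quotient m/l
    is merely bounded near the points of the sequence; the factor B^e makes the
    product continuous there, with value 0. On the circle,
    m/l <= l_D/l = exp G by Ahlfors' lemma. *)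
Lemma comparison_on_disk m r rho (e eta : R) :
  Phi I a m -> 0 < r -> r < rho -> rho < 1 -> 0 < e -> 0 <= eta ->
  (forall z, normc z = r -> ~ seq_points I a z) ->
  let h := poisson_extension rho (fun t => G (circle_point 0 r t)) in
  (forall z, normc z = r -> G z - eta <= h z) ->
  forall z, normc z <= r ->
    m z / l z * B z `^ e * expR (- h z) <= expR eta.
Proof.
move=> Phim r0 rrho rho1 e0 eta0 offr h bdry.
have [SKm _] := Phim; have [[cm m0 _] _] := SKm.
have r1 := lt_trans rrho rho1.
have inD z : normc z <= r -> unit_disk z by move=> h1; exact: le_lt_trans r1.
have circ_r t : normc (circle_point 0 r t) = r by rewrite normc_circle_point0// ltW.
have cF : continuous (fun t => G (circle_point 0 r t)).
  move=> t; apply: continuous_comp; first exact: continuous_circle_point.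
  by apply: contG; [apply: inD; rewrite circ_r|exact: offr].
have F0 t : 0 <= G (circle_point 0 r t) by exact: normr_ge0.
have ch z : normc z < rho -> {for z, continuous h}.
  exact: continuous_poisson_extension.
have h0 z : normc z < rho -> 0 <= h z by exact: poisson_extension_ge0.
pose v z := ln (l z) + h z + - e * ln (B z).
have expv z : unit_disk z -> ~ seq_points I a z ->
    expR (- v z) = (l z)^-1 * B z `^ e * expR (- h z).
  move=> zD nz; have B0 := blaschke_product_gt0 hC zD nz.
  rewrite /v !opprD !expRD (expRN (ln (l z))) lnK ?posrE ?lpos// mulNr opprK.
  by rewrite /powR gt_eqF// -mulrA [X in _ * X]mulrC mulrA.
apply: (@SK_max_principle R m v _ r _ SKm r1).
- apply: continuous_in_subspaceT => z; rewrite inE /= => zr.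
  have zD := inD _ zr; pose FF := @nbhs_filter _ z.
  have zrho : normc z < rho by exact: le_lt_trans rrho.
  have [zs|nz] := pselect (seq_points I a z); last first.
    have l0 := lpos zD nz; have B0 := blaschke_product_gt0 hC zD nz.
    apply: (@cvgM _ _ (nbhs z) FF); last first.
      apply: (@continuous_comp _ _ _ (fun z => - h z) (@expR R)); last first.
        exact: continuous_expR.
      by apply: (@cvgN _ _ _ (nbhs z) FF); exact: ch.
    apply: (@cvgM _ _ (nbhs z) FF).
      apply: (@cvgM _ _ (nbhs z) FF); first exact: disk_continuous.
      by apply: (@cvgV _ _ (nbhs z) FF); [rewrite gt_eqF|exact: contl].
    have eB : {for z, continuous (fun w => expR (e * ln (B w)))}.
      apply: (@continuous_comp _ _ _ (fun w => e * ln (B w)) (@expR R)); last first.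
        exact: continuous_expR.
      apply: (@cvgM _ _ (nbhs z) FF); first exact: (@cvg_cst _ _ _ (nbhs z) FF).
      exact: nbhs_singleton (near_continuous_ln_blaschke_product hC zD nz).
    rewrite (_ : B z `^ e = expR (e * ln (B z))); last by rewrite /powR gt_eqF.
    apply: cvg_trans eB.
    apply: (@near_eq_cvg _ _ (nbhs z) FF).
    have : \forall w \near z, expR (e * ln (B w)) = B w `^ e.
      apply: filterS (near_off_seq hC zD nz) => w [wD nw].
      by rewrite /powR gt_eqF// blaschke_product_gt0.
    exact.
  have [C C0 ratio] := zero_ratio_bounded cl zerol Phim zs zD.
  apply/(@cvgrPdist_lt _ _ _ _ FF) => d d0.
  have dC0 : 0 < d / 2 / C by rewrite !divr_gt0.
  have cB := continuous_blaschke_product hC zD.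
  have nearB : \forall w \near z, B w < (d / 2 / C) `^ e^-1.
    apply: (@cvgr_lt _ _ (nbhs z) FF _ _ cB).
    by rewrite (blaschke_product_seq hC zs) powR_gt0.
  apply: filterS (filterI (filterI ratio nearB) (filterI (near_disk zD) (near_disk zrho))).
  move=> w [[rw Bw] [wD wrho]].
  rewrite (blaschke_product_seq hC zs) powR0 ?gt_eqF// mulr0 mul0r sub0r normrN.
  have lw : 0 <= l w by exact: conformal_ge0 cl wD.
  have mw : 0 <= m w by exact: m0.
  rewrite ger0_norm ?mulr_ge0 ?expR_ge0 ?powR_ge0 ?invr_ge0//.
  have [->|wz] := eqVneq w z.
    by rewrite (blaschke_product_seq hC zs) powR0 ?gt_eqF// mulr0 mul0r.
  have Be : B w `^ e <= d / 2 / C.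
    rewrite (_ : d / 2 / C = ((d / 2 / C) `^ e^-1) `^ e); last first.
      by rewrite -powRrM mulVf ?gt_eqF// powRr1// ltW.
    by apply: ge0_ler_powR; rewrite ?nnegrE ?powR_ge0 ?blaschke_product_ge0 ?(ltW e0)// ltW.
  apply: (@le_lt_trans _ _ (C * (d / 2 / C) * 1)).
    apply: ler_pM; rewrite ?expR_ge0 ?mulr_ge0 ?powR_ge0 ?invr_ge0//.
      by apply: ler_pM; rewrite ?mulr_ge0 ?powR_ge0 ?invr_ge0// rw.
    by rewrite -expR0 ler_expR oppr_le0 h0.
  rewrite mulr1 mulrC divfK ?gt_eqF//; lra.
- move=> z zr; have nz := offr _ zr.
  have zD : unit_disk z by apply: inD; rewrite zr.
  have l0 := lpos zD nz; have B0 := blaschke_product_gt0 hC zD nz.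
  have B1 : B z `^ e <= 1.
    by apply: powR_le1; rewrite ?(ltW B0) ?(ltW e0)// blaschke_product_le1.
  have ml : m z / l z <= expR (G z).
    rewrite G_disk// expRB !lnK ?posrE// ?hyperbolic_density_gt0//.
    by apply: ler_wpM2r; [rewrite invr_ge0 ltW|exact: ahlfors SKm _ zD].
  apply: (@le_trans _ _ (expR (G z) * 1 * expR (- (G z - eta)))).
    apply: ler_pM; rewrite ?expR_ge0//.
    + by rewrite mulr_ge0 ?powR_ge0// divr_ge0 ?m0// ltW.
    + by apply: ler_pM => //; rewrite ?powR_ge0// divr_ge0 ?m0// ltW.
    + by rewrite ler_expR lerN2 bdry.
  by rewrite mulr1 -expRD opprB addrC subrK.
- move=> z zr KE; have zD : unit_disk z by apply: inD; exact: ltW.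
  have zrho : normc z < rho by exact: lt_trans rrho.
  have K1 : 1 <= expR eta by rewrite -expR0 ler_expR.
  have E1 := le_lt_trans K1 KE.
  have nz : ~ seq_points I a z.
    move=> zs; move: E1; rewrite (blaschke_product_seq hC zs) powR0 ?gt_eqF//.
    by rewrite mulr0 mul0r ltNge ler01.
  have l0 := lpos zD nz; have B0 := blaschke_product_gt0 hC zD nz.
  have B1 : B z `^ e <= 1.
    by apply: powR_le1; rewrite ?(ltW B0) ?(ltW e0)// blaschke_product_le1.
  have ratio1 : 1 < m z / l z.
    apply: lt_le_trans E1 _; rewrite -mulrA; apply: ler_piMr.
      by rewrite divr_ge0 ?m0// ltW.
    by rewrite mulr_ile1 ?powR_ge0 ?expR_ge0// -expR0 ler_expR oppr_le0 h0.
  have lm : l z < m z by move: ratio1; rewrite ltr_pdivlMr// mul1r.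
  have near_off := near_off_seq hC zD nz.
  have nearl : \forall w \near z, {for w, continuous l}.
    by apply: filterS (near_disk zD) => w; exact: contl.
  have clnl := near_continuous_ln nearl l0.
  have cnh : \forall w \near z, {for w, continuous h}.
    by apply: filterS (near_disk zrho) => w; exact: ch.
  have cnB := near_continuous_ln_blaschke_product hC zD nz.
  have cnB' : \forall w \near z, {for w, continuous (fun x => - e * ln (B x))}.
    apply: filterS cnB => w cB; apply: (@cvgM _ _ (nbhs w) (nbhs_filter w)); last exact: cB.
    exact: (@cvg_cst _ _ _ (nbhs w) (nbhs_filter w)).
  have cn1 : \forall w \near z, {for w, continuous (fun x => ln (l x) + h x)}.
    apply: filterS (filterI clnl cnh) => w [c1 c2].
    by apply: (@cvgD _ _ _ (nbhs w) (nbhs_filter w)); [exact: c1|exact: c2].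
  split.
  + exact: lt_trans lm.
  + apply: filterS (filterI cn1 cnB') => w [c1 c2].
    by apply: (@cvgD _ _ _ (nbhs w) (nbhs_filter w)); [exact: c1|exact: c2].
  + apply: filterS near_off => w [wD nw].
    by rewrite expv// !mulrA.
  + rewrite (@lower_laplacianD_mean_value R v (fun x => ln (l x) + h x)
      (fun x => - e * ln (B x)))//.
    * rewrite (@lower_laplacianD_mean_value R _ (fun x => ln (l x)) h)//.
      - rewrite (curvature_eq_lower_laplacian l0); last by case: curvl => _; apply.
        by rewrite lte_fin ltr_pM2l// ltr_pXn2r// nnegrE ltW// (lt_trans l0).
      - by apply/nbhs_normcP; exists 1.
      - exact: poisson_extension_mean_value.
    * by apply/nbhs_normcP; exists 1.
    * apply: mean_value_atZ => //; exact: ln_blaschke_product_mean_value.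
Qed.

Definition zero_hyperbolic_mean : Prop :=
  (\int[mu]_(t in `[0%R, (2 * pi)%R])
      lne (l (circle_point 0 r t) / hyperbolic_density (circle_point 0 r t))%:E)%E
    @[r --> 1^'-] --> 0%E.

(** The circle is chosen off the sequence, so that G is continuous on it. *)
Lemma small_circle_mean (d r0 : R) : zero_hyperbolic_mean -> 0 < d -> r0 < 1 ->
  exists r, [/\ r0 < r, r < 1, 0 < r, forall z, normc z = r -> ~ seq_points I a z &
    \int[mu]_(t in `[0, 2 * pi]) G (circle_point 0 r t) < d].
Proof.
move=> lim0 d0 r01.
have nearI : \forall r \near (1 : R)^'-, ((- d)%:E < \int[mu]_(t in `[0%R, (2 * pi)%R])
      lne (l (circle_point 0 r t) / hyperbolic_density (circle_point 0 r t))%:E)%E.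
  apply: (lim0 [set x | (- d)%:E < x]%E).
  apply: open_nbhs_nbhs; split; first exact: open_ereal_gt_ereal.
  by rewrite /= lte_fin oppr_lt0.
move: nearI => /nbhs_ballP[s /= s0 Hs].
have [|r /andP[r_gt r1] ar] := @radius_off_seq R a (Num.max (Num.max r0 0) (1 - s)).
  by rewrite !gt_max r01 ltr01 ltrBlDr ltrDl.
move: r_gt; rewrite !gt_max => /andP[/andP[rr0 rp] rs].
have offr z : normc z = r -> ~ seq_points I a z.
  by move=> zr [j _ aj]; have := ar j; rewrite aj zr eqxx.
exists r; split=> //.
have : ((- d)%:E < \int[mu]_(t in `[0%R, (2 * pi)%R])
      lne (l (circle_point 0 r t) / hyperbolic_density (circle_point 0 r t))%:E)%E.
  apply: Hs => //; rewrite /ball /= ger0_norm; lra.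
have circ_r t : normc (circle_point 0 r t) = r by rewrite normc_circle_point0// ltW.
have cD t : unit_disk (circle_point 0 r t) by apply: circle_in_disk => //; exact: ltW.
have cn t : ~ seq_points I a (circle_point 0 r t) by apply: offr.
have cF : continuous (fun t => G (circle_point 0 r t)).
  move=> t; apply: continuous_comp; first exact: continuous_circle_point.
  exact: contG.
rewrite (_ : (\int[mu]_(t in _) _)%E =
    (- \int[mu]_(t in `[0%R, (2 * pi)%R]) G (circle_point 0 r t))%:E).
  by rewrite lte_fin ltrN2.
have iF := continuous_integrable 0 (2 * pi) cF.
rewrite -mulN1r -RintegralZl// /Rintegral fineK; last first.
  apply: integrable_fin_num => //.
  apply: (continuous_integrable _ _ (f := fun t => -1 * G (circle_point 0 r t))) => t.
  by apply: cvgM; [exact: cvg_cst|exact: cF].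
apply: eq_integral => t _; rewrite lne_EFin; last first.
  by rewrite divr_gt0 ?lpos// hyperbolic_density_gt0.
by rewrite G_disk// ln_div ?posrE ?lpos ?hyperbolic_density_gt0// mulN1r opprB.
Qed.

(** If q = ln(m/l) were positive at z, it would be at most q/4 + q/4 + q/4: one
    term bounds -e ln B(z), one bounds h(z) through the circle mean of G, and
    one is the boundary error. *)
Lemma zero_mean_dominates_off m z : zero_hyperbolic_mean -> Phi I a m ->
  unit_disk z -> ~ seq_points I a z -> m z <= l z.
Proof.
move=> lim0 Phim zD nz; rewrite leNgt; apply/negP => lm.
have l0 := lpos zD nz; have m0 := lt_trans l0 lm.
have B0 := blaschke_product_gt0 hC zD nz.
have lnB : ln (B z) <= 0 by rewrite ln_le0// blaschke_product_le1.
pose q := ln (m z / l z).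
have q0 : 0 < q by rewrite ln_gt0// ltr_pdivlMr// mul1r.
have z0 := normc_ge0 z; have z1 : normc z < 1 by [].
(* Then - e ln B(z) <= q/4; the 1 covers the case B(z) = 1. *)
pose e := q / (4 * (1 - ln (B z))).
have den0 : 0 < 4 * (1 - ln (B z)) by lra.
have e0 : 0 < e by rewrite divr_gt0.
have eB : - (e * ln (B z)) <= q / 4.
  have -> : - (e * ln (B z)) = q / 4 * (- ln (B z) / (1 - ln (B z))).
    by rewrite /e; field; lra.
  rewrite ler_piMr ?divr_ge0 ?(ltW q0)// ler_pdivrMr; lra.
(* For (1+|z|)/2 < r < rho < 1 the kernel at z is at most 4/(1-|z|). *)
pose d := 2 * pi * (q * (1 - normc z) / 16).
have d0 : 0 < d by rewrite mulr_gt0 ?twopi_gt0// divr_gt0// mulr_gt0// subr_gt0.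
have [|r [zr r1 r0 offr Fd]] := small_circle_mean (r0 := (1 + normc z) / 2) lim0 d0.
  lra.
have rD w : normc w = r -> unit_disk w by rewrite /unit_disk /= => ->.
have q40 : 0 < q / 4 by rewrite divr_gt0.
have cGr w : normc w = r -> {for w, continuous G}.
  by move=> wr; apply: contG; [exact: rD|exact: offr].
have nearb := poisson_extension_boundary r0 q40 (fun w => normr_ge0 _ : 0 <= G w) cGr.
have FF : ProperFilter r^'+ by exact: at_right_proper_filter.
have [rho [bdry [rrho rho1]]] := @filter_ex _ _ FF _ (filterI nearb
  (filterI (nbhs_right_gt r) (nbhs_right_lt r1))).
have F0 t : 0 <= G (circle_point 0 r t) by exact: normr_ge0.
have cF : continuous (fun t => G (circle_point 0 r t)).
  move=> t; apply: continuous_comp; first exact: continuous_circle_point.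
  by apply: cGr; rewrite normc_circle_point0// ltW.
have zrho : normc z < rho by rewrite /= in rrho; lra.
have hq : poisson_extension rho (fun t => G (circle_point 0 r t)) z <= q / 4.
  apply: le_trans (poisson_extension_le cF F0 zrho) _.
  have kle : (rho + normc z) / (rho - normc z) <= 4 / (1 - normc z).
    rewrite ler_pdivrMr; last by rewrite subr_gt0.
    rewrite mulrAC ler_pdivlMr ?subr_gt0//; rewrite /= in rrho rho1; nra.
  apply: (@le_trans _ _ (4 / (1 - normc z) * ((2 * pi)^-1 * d))).
    apply: ler_pM => //.
    - by rewrite divr_ge0//; rewrite /= in rrho; lra.
    - by rewrite mulr_ge0 ?invr_ge0 ?(ltW (twopi_gt0))//; exact: Rintegral_ge0.
    - by rewrite ler_pM2l ?invr_gt0 ?twopi_gt0// ltW.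
  rewrite /d mulKf ?gt_eqF ?twopi_gt0//.
  rewrite le_eqVlt; apply/orP; left; apply/eqP; field; lra.
have zler : normc z <= r by lra.
have := comparison_on_disk Phim r0 rrho rho1 e0 (ltW q40) offr bdry zler.
set h := poisson_extension _ _ _ in hq *.
have -> : m z / l z * B z `^ e * expR (- h) = expR (q + e * ln (B z) - h).
  have Eq : expR q = m z / l z by rewrite lnK ?posrE ?divr_gt0.
  rewrite expRD (expRD q) Eq.
  by rewrite /powR gt_eqF.
rewrite ler_expR; lra.
Qed.

(** At a point of the sequence, by continuity from the points around it. *)
Lemma zero_mean_dominates m z : zero_hyperbolic_mean -> Phi I a m ->
  unit_disk z -> m z <= l z.
Proof.
move=> lim0 Phim zD; have [[[cm _ _] _] _] := Phim.
rewrite leNgt; apply/negP => lm.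
have cml : {for z, continuous (fun w => m w - l w)}.
  apply: (@cvgB _ _ _ (nbhs z) (nbhs_filter z)); last exact: contl.
  exact: disk_continuous.
have near_lm : \forall w \near z, 0 < m w - l w.
  by apply: near_gt0 => //; rewrite subr_gt0.
have : \forall w \near z,
    0 < m w - l w /\ (w != z -> unit_disk w /\ ~ seq_points I a w).
  exact: filterI near_lm (near_punctured_off_seq zD).
move=> /nbhs_normcP[d d0 Hd].
have zw : z + (d / 2)%:C != z.
  by rewrite addrC -subr_eq0 addrK -normc_gt0 normc_real normr_gt0 gt_eqF// divr_gt0.
have [] := Hd (z + (d / 2)%:C).
  rewrite [X in X - _]addrC addrK normc_real gtr0_norm ?divr_gt0//; lra.
move=> + /(_ zw)[wD nw]; rewrite subr_gt0 ltNge.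
by rewrite (zero_mean_dominates_off lim0 Phim).
Qed.

End comparison.

Lemma constant_curvature_Phi l : conformal_pseudometric unit_disk l ->
  constant_curvature_m4 unit_disk l -> has_zero_set unit_disk l I a -> Phi I a l.
Proof.
move=> cl curvl [_ zl]; split; first exact: constant_curvature_SK.
move=> w ws; have [c _ lc] := zl w ws.
have FF : Filter w^' by exact: within_filter.
apply: (@le_lt_trans _ _ (c + 1)%:E); last exact: ltry.
apply: (@limf_esup_le R _ _ _ _ _ FF).
have c1 : c + 1 > c by rewrite ltrDl.
apply: filterS (@cvgr_lt _ _ _ FF _ _ lc _ c1) => z zc.
by rewrite lee_fin ltW.
Qed.

End zero_mean_implies_maximal.

(** * The characterization of the maximal pseudometric *)

Theorem theorem4p4 (R : realType) (I : set nat) (a : nat -> cplx R)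
    (hC : finite_or_Blaschke I a)
    (lambda : cplx R -> R)
    (hlambda : conformal_pseudometric unit_disk lambda)
    (hcurv : constant_curvature_m4 unit_disk lambda)
    (hzero : has_zero_set unit_disk lambda I a) :
  (forall z, unit_disk z -> (lambda z)%:E = lambda_max I a z) <->
  (\int[lebesgue_measure]_(t in `[0%R, (2 * pi)%R])
      lne (lambda (circle_point 0 r t)
           / hyperbolic_density (circle_point 0 r t))%:E)%E
    @[r --> 1^'-] --> 0%E.
Proof.
have lambdaPhi := constant_curvature_Phi hlambda hcurv hzero.
split=> [hmax|hmean].
  have [cont _ _] := hlambda.
  apply: (squeezed_zero_mean hC) => // z zD; apply/andP; split.
    rewrite -lee_fin hmax//; apply: ereal_sup_ubound.
    by exists (blaschke_metric I a) => //; exact: blaschke_metric_Phi.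
  exact: ahlfors (constant_curvature_SK hlambda hcurv) _ zD.
move=> z zD; apply/eqP; rewrite eq_le; apply/andP; split.
  by apply: ereal_sup_ubound; exists lambda.
apply: ge_ereal_sup => _ [m mPhi <-]; rewrite lee_fin.
exact: (zero_mean_dominates hC hlambda hcurv hzero hmean mPhi zD).
Qed.
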